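(* Let $\Gamma$ be a non-elementary Gromov-hyperbolic group endowed with a finite symmetric generating set $S$ and let $\varphi:\Gamma\to\mathbb{R}$ be a subadditive function. Let $\nu$ be a probability measure on $\partial\Gamma$ in the Patterson--Sullivan measure class. Then there exists a constant $\Lambda\ge0$ such that \[ \lim_{n\to\infty}\frac{\varphi(\xi_n)}{n}=\Lambda \] for $\nu$-almost every $\xi\in\partial\Gamma$ and every geodesic ray $(\xi_n)$ with $\xi_n\to\xi$.
   Context: Subadditive: $\varphi(gh)\le\varphi(g)+\varphi(h)$. $|g|_S$ is word length. A geodesic ray is a sequence $(\xi_n)_{n\ge0}$ in $\Gamma$ with $|\xi_n^{-1}\xi_m|_S=m-n$ for $m\ge n$; $\partial\Gamma$ is the set of geodesic rays modulo the relation $\sup_n|\xi_n^{-1}\xi'_n|_S<\infty$, and $\xi_n\to\xi$ means $(\xi_n)$ is a ray in the class $\xi$; $\Gamma\cup\partial\Gamma$ carries the usual compact topology. Let $\lambda>1$ be the exponential growth rate of $\#\{g:|g|_S=n\}$. A Patterson--Sullivan measure is a weak limit on $\Gamma\cup\partial\Gamma$ of $\frac{\sum_{|g|_S\le n}\lambda^{-|g|_S}\delta_g}{\sum_{|g|_S\le n}\lambda^{-|g|_S}}$ as $n\to\infty$ (equivalently of $\frac{\sum_g\lambda^{-s|g|_S}\delta_g}{\sum_g\lambda^{-s|g|_S}}$ as $s\searrow1$); it is supported on $\partial\Gamma$. The Patterson--Sullivan measure class consists of measures mutually absolutely continuous with it. *)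

(* Defs.v *)
From HB Require Import structures.
From mathcomp Require Import all_boot all_order all_algebra.
From mathcomp Require Import all_classical all_reals all_analysis.
From mathcomp Require Import monoid.
Set Implicit Arguments. Unset Strict Implicit. Unset Printing Implicit Defensive.
Import Order.TTheory GRing.Theory Num.Theory.
Import numFieldNormedType.Exports.
Local Open Scope classical_set_scope.
Local Open Scope ring_scope.

Section Hyperbolic.
Variables (G : groupType) (S : seq G).

Definition wprod (w : seq G) : G := foldr (fun a b => (a * b)%g) 1%g w.

Fixpoint words (n : nat) : seq (seq G) :=
  if n is n'.+1 then [seq s :: w | s <- S, w <- words n'] else [:: [::]].

Definition symmetric_gen : Prop := forall s, s \in S -> (s^-1)%g \in S.
Definition generates : Prop :=
  forall g : G, exists w : seq G, all (mem S) w /\ wprod w = g.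

Definition has_len (g : G) (n : nat) : bool :=
  `[< exists w : seq G, [/\ all (mem S) w, size w = n & wprod w = g] >].

(* word length |g|_S (defined as 0 if g is not in the generated subgroup) *)
Definition wordlen (g : G) : nat :=
  match pselect (exists n, has_len g n) with
  | left h => ex_minn h
  | right _ => 0%N
  end.

Definition wdist (x y : G) : nat := wordlen ((x^-1) * y)%g.

Definition gprod (R : realType) (x y w : G) : R :=
  ((wdist w x)%:R + (wdist w y)%:R - (wdist x y)%:R) / 2.

Definition gromov_hyperbolic (R : realType) : Prop :=
  exists delta : R, 0 <= delta /\ forall x y z w : G,
    gprod R x z w >= Num.min (gprod R x y w) (gprod R y z w) - delta.

Definition zpow (a : G) (k : int) : G :=
  match k with Posz n => (a ^+ n)%g | Negz n => ((a ^+ n.+1)^-1)%g end.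

(* virtually cyclic: a cyclic subgroup of finite index (finite groups included) *)
Definition virtually_cyclic : Prop :=
  exists (a : G) (F : seq G), forall x : G,
    exists2 f, f \in F & exists k : int, x = (f * zpow a k)%g.

(* a hyperbolic group is non-elementary iff it is not virtually cyclic *)
Definition non_elementary : Prop := ~ virtually_cyclic.

Definition sphere (n : nat) : seq G :=
  [seq g <- undup (map wprod (words n)) | wordlen g == n].
Definition ball (n : nat) : seq G :=
  undup (flatten [seq map wprod (words k) | k <- iota 0 n.+1]).

Definition geodesic_ray (r : nat -> G) : Prop :=
  forall n m, (n <= m)%N -> wdist (r n) (r m) = (m - n)%N.
Definition ray_equiv (r r' : nat -> G) : Prop :=
  exists C : nat, forall n, (wdist (r n) (r' n) <= C)%N.

Record bpoint := BPoint {
  bclass : set (nat -> G);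
  bclass_ok : exists r, geodesic_ray r /\
                bclass = [set r' | geodesic_ray r' /\ ray_equiv r r'] }.

Inductive compactification :=
  | Pt of G
  | Bd of bpoint.
HB.instance Definition _ := gen_eqMixin compactification.
HB.instance Definition _ := gen_choiceMixin compactification.
HB.instance Definition _ := isPointed.Build compactification (Pt 1%g).

Definition represents (x : compactification) (a : nat -> G) : Prop :=
  match x with
  | Pt g => forall n, a n = g
  | Bd xi => bclass xi a
  end.

(* basic neighbourhoods: {g} for g in Gamma, and
   {y | (xi|y)_1 > t} for xi in the boundary *)
Definition basic_nbhd (R : realType) (x : compactification)
  (B : set compactification) : Prop :=
  match x with
  | Pt g => B = [set Pt g]
  | Bd xi => exists t : R, B = [set y | exists a b, represents x a /\
        represents y b /\ exists N, forall i j, (N <= i)%N -> (N <= j)%N ->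
        gprod R (a i) (b j) 1%g > t]
  end.

Definition open_set (R : realType) (U : set compactification) : Prop :=
  forall x, U x -> exists B, basic_nbhd R x B /\ B `<=` U.

Definition borel_space (R : realType) : measurableType _ :=
  @g_sigma_algebraType compactification (@open_set R).

Definition cont_fun (R : realType) (f : compactification -> R) : Prop :=
  forall x (e : R), 0 < e -> exists B, basic_nbhd R x B /\
     forall y, B y -> `|f y - f x| < e.

Definition bounded_fun (R : realType) (f : compactification -> R) : Prop :=
  exists M : R, forall x, `|f x| <= M.

(* the normalized measure sum_{|g|<=n} lam^{-|g|} delta_g, integrated against f *)
Definition ps_avg (R : realType) (lam : R) (n : nat) (f : compactification -> R) : R :=
  (\sum_(g <- ball n) lam ^- wordlen g * f (Pt g)) /
  (\sum_(g <- ball n) lam ^- wordlen g).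

Definition patterson_sullivan (R : realType) (lam : R)
  (mu : probability (borel_space R) R) : Prop :=
  exists nk : nat -> nat, (forall k, (nk k < nk k.+1)%N) /\
    forall f : borel_space R -> R, cont_fun f -> bounded_fun f ->
      (fun k : nat => ps_avg lam (nk k) f : R) @ \oo -->
        (fine (\int[mu]_x (f x)%:E) : R).

Definition abs_cont (R : realType) (nu mu : probability (borel_space R) R) : Prop :=
  forall A : set (borel_space R), measurable A -> mu A = 0%E -> nu A = 0%E.

Definition in_PS_class (R : realType) (lam : R)
  (nu : probability (borel_space R) R) : Prop :=
  exists mu, patterson_sullivan lam mu /\ abs_cont nu mu /\ abs_cont mu nu.

End Hyperbolic.

Section Extra.
Local Open Scope ring_scope.
Definition growth_rate (R : realType) (G : groupType) (S : seq G) (lam : R) : Prop :=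
  (fun n : nat => ((size (sphere S n))%:R : R) `^ (n%:R)^-1) @ \oo --> lam.

Definition subadditive_fun (R : realType) (G : groupType) (phi : G -> R) : Prop :=
  forall g h : G, phi (g * h)%g <= phi g + phi h.
End Extra.

(* Main.v *)
(** The comparison of the sums of [lam ^- |h|] before and after a translation by
    [g] shows that a Patterson-Sullivan measure [mu] satisfies
    [mu (g A) <= lam ^ |g| * mu A], and, on the points whose geodesics from [1]
    pass near [g], the reverse scaling [mu (g A) <= C * lam ^- |g| * mu A].
    This needs spheres of size comparable with [lam ^ n]: any [g], [h] can be
    joined by a bounded [u] with [|g u h| >= |g| + |h| - C], because otherwise the
    group would almost fix a boundary point, and the Busemann quasimorphism of
    this point, whose fibres are finite, would make the group virtually cyclic.

    Every Borel set is asymptotically a union of shadows, while an invariant set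
    that is neither null nor full occupies in every shadow a proportion bounded
    away from 0 and 1; hence the action on the boundary is ergodic.  So the upper and lower limits of [phi (xi_n) / n], which are
    invariant, are almost everywhere constant.  If the lower limit were below
    [s] and the upper one above [t > s], then, as in the proof of Katznelson and
    Weiss of Kingman's theorem, rays could be cut into segments of slope at most
    [s] and bad points of arbitrarily small measure, so that the bad points would
    have positive upper density along almost every ray; a maximal inequality for
    the recentred rays excludes this.  Finally the limit is nonnegative because
    spheres are symmetric and [phi g + phi g^-1 >= phi 1 >= 0]. *)

(* All the geometry rests on the four-point inequality with a natural constant [D]: Gromov products
   are doubled, lengths stay integral, and each estimate costs a multiple of [D]. Boundary points
   are handled through far group elements: in the extension lemma a far [q] stands for the almost
   fixed boundary point, and a geodesic from [1] is replaced by a choice, for each length, of an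
   element whose shadow contains the endpoint.

   A weak limit is seen by continuous functions only, so the inequalities between finite sums reach
   Borel sets by an approximation valid for [mu] and for a translate of it at once. Shadows are
   replaced by Borel windows squeezed between two of them; the ergodic part knows [mu] only through
   these windows and the two scaling inequalities.

   The Katznelson-Weiss argument would want a measure invariant under recentring. Its substitute is
   that a set transported to time [k] has measure at most a constant times its own, uniformly in
   [k]. The resulting maximal inequality loses a constant, which is harmless because the bad set can
   be made arbitrarily small. *)
Require Import Defs.
From HB Require Import structures.
From mathcomp Require Import all_boot all_order all_algebra.
From mathcomp Require Import all_classical all_reals all_analysis.
From mathcomp Require Import measurable_realfun monoid zify ring lra.
Set Implicit Arguments. Unset Strict Implicit. Unset Printing Implicit Defensive.
Import Order.TTheory GRing.Theory Num.Theory.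
Import numFieldNormedType.Exports.
Local Open Scope classical_set_scope.
Local Open Scope ring_scope.

(** * Word metric *)

(* The products and inverses in a goal may mention different instances for the
   same group; [glia] identifies them before calling [lia]. *)
Definition gmul (G : groupType) (x y : G) : G := (x * y)%g.
Definition ginv (G : groupType) (x : G) : G := (x^-1)%g.
Ltac glia :=
  intros;
  repeat match goal with
  | |- context [@mul ?M ?x ?y] => change (@mul M x y) with (gmul x y)
  | H : context [@mul ?M ?x ?y] |- _ => change (@mul M x y) with (gmul x y) in H
  | |- context [@inv ?M ?x] => change (@inv M x) with (ginv x)
  | H : context [@inv ?M ?x] |- _ => change (@inv M x) with (ginv x) in H
  end; lia.

(* Restatements of [mulgA] and [invgM] whose products are syntactically those of
   a group, so that rewritten terms are the same atoms for [lia]. *)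
Lemma gmulA (G : groupType) (x y z : G) : (x * (y * z) = x * y * z)%g.
Proof. exact: mulgA. Qed.

Lemma ginvM (G : groupType) (x y : G) : ((x * y)^-1 = y^-1 * x^-1)%g.
Proof. exact: invgM. Qed.

Section WordMetric.
Variables (G : groupType) (S : seq G).
Hypotheses (symS : symmetric_gen S) (genS : generates S).
Local Notation len := (wordlen S).
Local Notation dist := (wdist S).

Lemma wprod_cat (u v : seq G) : wprod (u ++ v) = (wprod u * wprod v)%g.
Proof. by elim: u => [|a u IH] /=; rewrite ?mul1g // IH gmulA. Qed.

Lemma has_lenP g n :
  reflect (exists w : seq G, [/\ all (mem S) w, size w = n & wprod w = g])
          (has_len S g n).
Proof. exact: asboolP. Qed.

Lemma wordlen_ex g :
  exists w : seq G, [/\ all (mem S) w, size w = len g & wprod w = g].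
Proof.
rewrite /wordlen; case: pselect => [h|[]].
  by case: ex_minnP => m /has_lenP.
by have [w [wS wg]] := genS g; exists (size w); apply/has_lenP; exists w.
Qed.

Lemma wordlen_le w : all (mem S) w -> (len (wprod w) <= size w)%N.
Proof.
move=> wS; have h : has_len S (wprod w) (size w) by apply/has_lenP; exists w.
rewrite /wordlen; case: pselect => [h'|[]]; last by exists (size w).
by case: ex_minnP => m _; apply.
Qed.

Lemma wordlen1 : len 1%g = 0%N.
Proof. by apply/eqP; rewrite -leqn0 (@wordlen_le [::]). Qed.

Lemma wordlenM g h : (len (g * h)%g <= len g + len h)%N.
Proof.
have [u [uS <- <-]] := wordlen_ex g; have [v [vS <- <-]] := wordlen_ex h.
by rewrite -wprod_cat -size_cat wordlen_le // all_cat uS.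
Qed.

Lemma wordlenV_le g : (len g^-1%g <= len g)%N.
Proof.
have [u [uS <- <-]] := wordlen_ex g.
elim: u uS => [_|a u IH /= /andP[aS uS]] /=; first by rewrite invg1 wordlen1.
rewrite ginvM (leq_trans (wordlenM _ _)) // -addn1 leq_add ?IH //.
by have := @wordlen_le [:: a^-1%g]; rewrite /= mulg1 andbT; apply; apply: symS.
Qed.

Lemma wordlenV g : len g^-1%g = len g.
Proof.
by apply/eqP; rewrite eqn_leq wordlenV_le -{1}[g]invgK wordlenV_le.
Qed.

Lemma wdist1g g : dist 1%g g = len g.
Proof. by rewrite /wdist invg1 mul1g. Qed.

Lemma wdistxx g : dist g g = 0%N.
Proof. by rewrite /wdist mulVg wordlen1. Qed.

Lemma wdistC g h : dist g h = dist h g.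
Proof. by rewrite /wdist -wordlenV ginvM invgK. Qed.

Lemma wdistg1 g : dist g 1%g = len g.
Proof. by rewrite wdistC wdist1g. Qed.

Lemma wdist_triangle y x z : (dist x z <= dist x y + dist y z)%N.
Proof.
rewrite /wdist (leq_trans _ (wordlenM _ _)) //.
by rewrite gmulA mulgK.
Qed.

Lemma wdistMl g x y : dist (g * x)%g (g * y)%g = dist x y.
Proof. by rewrite /wdist ginvM -gmulA mulKg. Qed.

Lemma wdistMr x u : dist x (x * u)%g = len u.
Proof. by rewrite /wdist mulKg. Qed.

Lemma geodesic_point g n : (n <= len g)%N ->
  exists p, len p = n /\ (dist p g + n = len g)%N.
Proof.
move=> n_le; have [w [wS sw wg]] := wordlen_ex g.
exists (wprod (take n w)).
have := wS; rewrite -{1}[w](cat_take_drop n) all_cat => /andP[tS dS].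
have Etd : g = (wprod (take n w) * wprod (drop n w))%g.
  by rewrite -wprod_cat cat_take_drop.
have dE : dist (wprod (take n w)) g = len (wprod (drop n w)).
  by rewrite {1}Etd wdistMr.
have := wordlen_le tS; have := wordlen_le dS; rewrite -dE size_takel ?sw //.
rewrite size_drop sw => le1 le2.
by have := wordlenM (wprod (take n w)) (wprod (drop n w)); rewrite -Etd -dE; lia.
Qed.

Lemma mem_words n w : (w \in words S n) = (size w == n) && all (mem S) w.
Proof.
elim: n w => [|n IH] [|a w] //=.
  by apply/negbTE/allpairsP => -[[x y] [] //].
apply/allpairsP/idP => [[[x y] /= [xS yw [-> ->]]]|].
  by rewrite xS eqSS /= -IH.
by case/and3P => sw aS wS; exists (a, w); rewrite /= aS IH wS andbT -eqSS.
Qed.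

Lemma mem_sphere n g : (g \in sphere S n) = (len g == n).
Proof.
rewrite mem_filter mem_undup; case: eqVneq => //= <-.
have [w [wS sw wg]] := wordlen_ex g; rewrite -{1}wg; apply/map_f.
by rewrite mem_words sw eqxx.
Qed.

Lemma sphere_uniq n : uniq (sphere S n).
Proof. exact/filter_uniq/undup_uniq. Qed.

Lemma mem_wball n g : (g \in Defs.ball S n) = (len g <= n)%N.
Proof.
rewrite mem_undup; apply/flattenP/idP => [[s /mapP[k]]|le_n].
  rewrite mem_iota add0n ltnS => /= kn -> /mapP[w].
  by rewrite mem_words => /andP[/eqP wk wS] ->; rewrite (leq_trans (wordlen_le wS)) ?wk.
exists (map (@wprod G) (words S (len g))); last first.
  have [w [wS sw wg]] := wordlen_ex g; rewrite -{1}wg; apply/map_f.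
  by rewrite mem_words sw eqxx.
by apply/mapP; exists (len g) => //; rewrite mem_iota add0n ltnS.
Qed.

Lemma wball_uniq n : uniq (Defs.ball S n).
Proof. exact: undup_uniq. Qed.

End WordMetric.

Section Zpow.
Variables (G : groupType).
Implicit Types a : G.

Lemma zpow0 a : zpow a 0 = 1%g. Proof. exact: expg0. Qed.

Lemma zpowS a (k : int) : zpow a (k + 1) = (zpow a k * a)%g.
Proof.
case: k => n; first by rewrite -PoszD /= addn1 expgSr.
case: n => [|n]; first by rewrite /= expg1 mulVg.
have -> : Negz n.+1 + 1 = Negz n by lia.
by rewrite /= [in RHS]expgS invgM mulgVK.
Qed.

Lemma zpowB1 a (k : int) : zpow a (k - 1) = (zpow a k * a^-1)%g.
Proof. by apply: (@mulIg _ a); rewrite -zpowS subrK mulgVK. Qed.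

Lemma zpowD a (j k : int) : zpow a (j + k) = (zpow a j * zpow a k)%g.
Proof.
elim/int_rect: k => [|n IH|n IH]; first by rewrite addr0 zpow0 mulg1.
  by rewrite intS [1 + _]addrC addrA !zpowS IH mulgA.
have -> : - n.+1%:Z = - n%:Z - 1 by lia.
by rewrite addrA !zpowB1 IH mulgA.
Qed.

Lemma zpowN a (k : int) : zpow a (- k) = ((zpow a k)^-1)%g.
Proof. by apply/esym/mulg1_eq; rewrite -zpowD subrr zpow0. Qed.

End Zpow.

Lemma monochromatic (T : eqType) (X : seq T) (c : T -> nat) (k m : nat) :
  (forall x, x \in X -> c x < k)%N -> (k * m < size X)%N ->
  exists i, (m < size [seq x <- X | c x == i])%N.
Proof.
elim: k X => [|k IH] X ck sX.
  by case: X ck sX => // x X /(_ x); rewrite mem_head => /(_ isT).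
have [lt_m|le_m] := ltnP m (size [seq x <- X | c x == k]); first by exists k.
have [x||i] := IH [seq x <- X | c x != k].
- by rewrite mem_filter => /andP[ck' /ck]; rewrite ltnS leq_eqVlt (negbTE ck').
- move: sX le_m; rewrite mulSn -(count_predC (fun x => c x == k)) !size_filter.
  by rewrite -[count (predC _) X]/(count (fun x => c x != k) X); lia.
- rewrite -filter_predI => lt_m; exists i; apply: leq_trans lt_m _.
  by rewrite !size_filter; apply: sub_count => x /= /andP[].
Qed.

(** Hyperbolicity with doubled products: no base point is singled out, and all consequences become
    linear arithmetic over natural numbers. *)
Definition four_point (G : groupType) (S : seq G) (D : nat) :=
  forall x y z w, (wdist S x z + wdist S y w <=
    maxn (wdist S x y + wdist S z w) (wdist S y z + wdist S x w) + D)%N.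

Lemma gromov_four_point (R : realType) (G : groupType) (S : seq G) :
  symmetric_gen S -> generates S ->
  gromov_hyperbolic S R -> exists D, four_point S D.
Proof.
(* Doubling the products doubles [delta], which is then rounded up. *)
move=> symS genS [delta [delta0 hyp]]; exists (Num.bound (delta * 2)) => x y z w.
have lt_b : delta * 2 < (Num.bound (delta * 2))%:R :> R.
  by rewrite archi_boundP // mulr_ge0.
have := hyp x y z w; rewrite /gprod ![wdist S w _]wdistC //.
move: (wdist S x z) (wdist S y w) (wdist S x y) (wdist S z w) (wdist S y z)
  (wdist S x w) => a b c d e f H.
rewrite -(ler_nat R) !natrD natr_max !natrD -lerBlDr le_max.
move: H; rewrite lerBlDr ge_min => /orP[] H; apply/orP; [left|right]; lra.
Qed.

(** * Extension lemma and growth of spheres *)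

Section Extension.
Variables (G : groupType) (S : seq G).
Hypotheses (symS : symmetric_gen S) (genS : generates S).
Local Notation len := (wordlen S).
Local Notation dist := (wdist S).
Local Notation lenM := (wordlenM genS).
Local Notation lenV := (wordlenV symS genS).
Variable D : nat.
Hypothesis hypD : four_point S D.

Lemma gromov_min x y z :
  (dist x z + len y <= maxn (dist x y + len z) (dist y z + len x) + D)%N.
Proof. by have := hypD x y z 1%g; rewrite !wdistg1. Qed.

Lemma len_mul_ge u v : (len v <= len u + len (u * v)%g)%N.
Proof. by rewrite -(lenV u) -{1}[v](mulKg u) lenM. Qed.

(* The geodesics from [1] to [q] and to [w q] share their initial segment of
   length [M / 2]. *)
Definition fellow (q : G) (M : nat) (w : G) :=
  (M + dist q (w * q)%g <= len q + len (w * q)%g)%N.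

Lemma fellowW q M N w : (N <= M)%N -> fellow q M w -> fellow q N w.
Proof. by rewrite /fellow; glia. Qed.

Lemma fellowV q M w : fellow q (M + 2 * len w) w -> fellow q M w^-1%g.
Proof.
rewrite /fellow; have <- := wdistMl S w q (w^-1 * q)%g; rewrite mulVKg.
rewrite [wdist S (w * q)%g q]wdistC //.
by have := lenM w q; have := len_mul_ge w^-1%g q; rewrite lenV; glia.
Qed.

(** Translation by [w] changes the product of [q] and [v q] by at most [2 * len w], and comparing
    [q], [w q], [w v q] costs [D]. *)
Lemma fellowM q M w v :
  fellow q (M + D) w -> fellow q (M + D + 2 * len w) v -> fellow q M (w * v)%g.
Proof.
rewrite /fellow -gmulA; have := wdistMl S w q (v * q)%g.
have := gromov_min q (w * q)%g (w * (v * q))%g.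
have := len_mul_ge w q; have := len_mul_ge w (v * q)%g; have := lenM w q.
have := lenM w (v * q)%g; glia.
Qed.

(** The differences [|w q| - |q|] and [|w v q| - |v q|] compare the distances from [w^-1] and from
    [1], seen from [q] and from [v q]. These two targets separate only beyond distance [M / 2],
    hence beyond [w^-1], so they see almost the same difference. Thus the displacement [|w q| - |q|]
    is a quasimorphism with defect [D], a finite form of the Busemann quasimorphism. *)
Lemma fellow_quasimorphism q M w v :
  (2 * len w <= M)%N -> fellow q M v ->
  (len (w * v * q)%g + len q <= len (w * q)%g + len (v * q)%g + D)%N /\
  (len (w * q)%g + len (v * q)%g <= len (w * v * q)%g + len q + D)%N.
Proof.
rewrite /fellow => le_M fv.
have h1 := hypD 1%g w^-1%g q (v * q)%g; have h2 := hypD 1%g w^-1%g (v * q)%g q.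
have E1 : dist w^-1%g (v * q)%g = len (w * v * q)%g.
  by rewrite -(wdistMl S w) mulgV gmulA wdist1g.
have E2 : dist w^-1%g q = len (w * q)%g by rewrite -(wdistMl S w) mulgV wdist1g.
move: h1 h2; rewrite !wdist1g E1 E2 lenV [dist (v * q)%g q]wdistC //.
have := lenM w q; have := lenM w (v * q)%g; have := lenM w v.
have := len_mul_ge w q; have := len_mul_ge w (v * q)%g; rewrite gmulA.
glia.
Qed.

(** Let [z] be the point at distance [L] on a geodesic from [1] to [q]. Since [len w <= L], the
    point [w z] lies where the geodesic from [w] to [w q] already follows the one to [q], and
    [4 * L <= M] keeps it in the common part. Its height there is [L] plus the displacement of [w],
    up to [D]. So all the [w z] are close to each other, and [w] is recovered from
    [z^-1 w0^-1 w z]. *)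
Lemma fellow_fibre q M L K (E : seq G) :
  uniq E -> (4 * L <= M)%N ->
  (forall w : G, w \in E -> [/\ (len w <= L)%N, fellow q M w,
     (len (w * q)%g <= len q + K)%N & (len q <= len (w * q)%g + K)%N]) ->
  (size E <= size (Defs.ball S (2 * K + 5 * D)))%N.
Proof.
case: E => [|w0 E] // uE LM hE.
have [z [lz dz]] : exists z, len z = L /\ (dist z q + L = len q)%N.
  apply: geodesic_point => //; have [l0 f0 _ _] := hE w0 (mem_head _ _).
  move: f0; rewrite /fellow; have := wdist_triangle genS q 1%g (w0 * q)%g.
  by rewrite !wdist1g; glia.
have close (w : G) : w \in w0 :: E ->
    [/\ (len (w * z)%g + len q <= len (w * q)%g + L + D)%N &
        (len (w * q)%g + L <= len (w * z)%g + len q + D)%N].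
  move=> /hE[lw _ _ _].
  have h1 := hypD 1%g w (w * z)%g (w * q)%g; have h2 := hypD 1%g w (w * q)%g (w * z)%g.
  have := wdistMl S w z q; have := wdistMr S w z; have := wdistMr S w q.
  move: h1 h2; rewrite !wdist1g [dist (w * q)%g (w * z)%g]wdistC //.
  have := lenM w q; have := lenM w z; have := len_mul_ge w q; have := len_mul_ge w z.
  glia.
rewrite -(size_map (fun w => (z^-1 * (w0^-1 * (w * z))))%g).
apply: uniq_leq_size.
  rewrite map_inj_uniq // => u v /=; do 2 move/mulgI; exact: mulIg.
move=> _ /mapP[/= w wE ->].
have -> : (z^-1 * (w0^-1 * (w * z)) = (w0 * z)^-1 * (w * z))%g.
  by rewrite ginvM gmulA.
rewrite mem_wball // -/(wdist S _ _).
have [lw fw b1 b2] := hE w wE; have [l0 f0 b3 b4] := hE w0 (mem_head _ _).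
have [c1 c2] := close _ wE; have [c3 c4] := close _ (mem_head _ _).
move: fw f0; rewrite /fellow.
have := gromov_min (w0 * q)%g q (w * q)%g.
have := gromov_min (w0 * q)%g (w * q)%g (w * z)%g.
have := gromov_min (w0 * z)%g (w0 * q)%g (w * z)%g.
have := wdistMl S w z q; have := wdistMl S w0 z q.
rewrite [dist (w0 * q)%g q]wdistC // [dist (w * q)%g (w * z)%g]wdistC //.
have := lenM w z; have := lenM w0 z.
glia.
Qed.

(* The displacement [|a q| - |q|] exceeds the defect [2 D] of the quasimorphism,
   so that powers of [a] bring the displacement of [x] into a bounded range. *)
Lemma fellow_reduce q A L N a n x :
  (len a <= A)%N -> fellow q (N + n * D + 2 * L + 2 * A) a ->
  (2 * L + 2 * A <= N)%N ->
  (len q + 2 * D < len (a * q)%g)%N || (len (a * q)%g + 2 * D < len q)%N ->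
  (len (x * q)%g <= len q + (A + D + n))%N ->
  (len q <= len (x * q)%g + (A + D + n))%N ->
  (len x + n * A <= L)%N -> fellow q (N + n * D) x ->
  exists j : int, let y := (x * zpow a j)%g in
  [/\ (len y <= L)%N, fellow q N y, (len (y * q)%g <= len q + (A + D))%N
    & (len q <= len (y * q)%g + (A + D))%N].
Proof.
move=> lA fa LN ha.
have fa' : fellow q (N + n * D + 2 * L) a^-1%g.
  by apply: fellowV; apply: fellowW fa; glia.
(* As [a a^-1 = 1] has displacement 0, a displacement of [a] beyond [2 * D] forces one of opposite
   sign beyond [D] for [a^-1]. Hence one of the two factors strictly moves the displacement of [x]
   in the wanted direction despite the defect [D]. *)
have ha' : (len q + 2 * D < len (a * q)%g)%N && (len (a^-1 * q)%g + D < len q)%N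
        || (len (a * q)%g + 2 * D < len q)%N && (len q + D < len (a^-1 * q)%g)%N.
  have [] := @fellow_quasimorphism q (2 * A) a a^-1%g; first by glia.
    by apply: fellowW fa'; glia.
  rewrite mulgV mul1g. glia.
(* [n] bounds the excess displacement; each multiplication lowers it and uses up [A] of the length
   and [D] of the fellowship. *)
elim: n x fa fa' => [|n IH] x fa fa' b1 b2 lx fx.
  by exists 0; rewrite zpow0 mulg1; split=> //; [glia|rewrite mul0n addn0 in fx|glia..].
have fa1 : fellow q (N + n * D + 2 * L + 2 * A) a by apply: fellowW fa; glia.
have fa1' : fellow q (N + n * D + 2 * L) a^-1%g by apply: fellowW fa'; glia.
have step (s : G) (e : int) : (s = a /\ e = 1) \/ (s = a^-1%g /\ e = -1) ->
    (len (x * s * q)%g <= len q + (A + D + n))%N ->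
    (len q <= len (x * s * q)%g + (A + D + n))%N ->
  exists j : int, let y := (x * zpow a j)%g in
  [/\ (len y <= L)%N, fellow q N y, (len (y * q)%g <= len q + (A + D))%N
    & (len q <= len (y * q)%g + (A + D))%N].
  move=> sE b3 b4.
  have ls : (len s <= A)%N by case: sE => -[-> _] //; rewrite lenV.
  have fs : fellow q (N + n * D + D + 2 * L) s.
    by case: sE => -[-> _]; [apply: fellowW fa|apply: fellowW fa']; glia.
  have zs j : (s * zpow a j = zpow a (e + j))%g.
    by rewrite zpowD; case: sE => -[-> ->]; congr mul; rewrite /= expg1.
  have [//|//|//|//|||j] := IH (x * s)%g.
  - by have := lenM x s; glia.
  - apply: fellowM; first by apply: fellowW fx; glia.
    by apply: fellowW fs; glia.
  - by rewrite /= -gmulA zs => H; exists (e + j).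
have qm : forall s, fellow q (2 * L) s ->
    (len (x * s * q)%g + len q <= len (x * q)%g + len (s * q)%g + D)%N /\
    (len (x * q)%g + len (s * q)%g <= len (x * s * q)%g + len q + D)%N.
  by move=> s fs; apply: fellow_quasimorphism fs; glia.
have [|q1 q2] := qm a; first by apply: fellowW fa; glia.
have [|q3 q4] := qm a^-1%g; first by apply: fellowW fa'; glia.
have la1 := lenM a q; have la2 := len_mul_ge a q.
have la3 := lenM a^-1%g q; have la4 := len_mul_ge a^-1%g q; rewrite lenV in la3 la4.
have [lt|le] := ltnP (len q + (A + D + n)) (len (x * q)%g).
  case/orP: ha' => /andP[h1 h2].
    by apply: (step a^-1%g (-1)); [right|glia..].
  by apply: (step a 1); [left|glia..].
have [lt'|le'] := ltnP (len (x * q)%g + (A + D + n)) (len q).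
  case/orP: ha' => /andP[h1 h2].
    by apply: (step a 1); [left|glia..].
  by apply: (step a^-1%g (-1)); [right|glia..].
apply: IH => //; first by glia.
by apply: fellowW fx; glia.
Qed.

End Extension.

(** * Joining group elements by bounded connectors *)

Section ExtensionLemma.
Variables (G : groupType) (S : seq G).
Hypotheses (symS : symmetric_gen S) (genS : generates S) (neG : non_elementary G).
Local Notation len := (wordlen S).
Local Notation dist := (wdist S).
Local Notation lenM := (wordlenM genS).
Local Notation lenV := (wordlenV symS genS).

(** A finite family of coset representatives would make the group virtually cyclic, so the family
    can always be extended. For [a = 1] this says that the group is infinite. *)
Lemma distinct_cosets (a : G) n : exists X : seq G, [/\ size X = n, uniq X &
  forall (x y : G) k, x \in X -> y \in X -> x = (y * zpow a k)%g -> x = y].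
Proof.
elim: n => [|n [X [sX uX hX]]]; first by exists [::].
have [x hx] : exists x, forall (f : G) k, f \in X -> x <> (f * zpow a k)%g.
  apply: contrapT => /forallNP H; apply: neG; exists a, X => x.
  have /existsNP[f /existsNP[k /not_implyP[fX /contrapT xE]]] := H x.
  by exists f => //; exists k.
exists (x :: X); split => [||y z k]; first by rewrite /= sX.
  rewrite /= uX andbT; apply/negP => xX; apply: (hx x 0 xX).
  by rewrite zpow0 mulg1.
rewrite !inE => /orP[/eqP->|yX] /orP[/eqP->|zX] // E; last exact: hX E.
- by have := hx z k zX.
- by case: (hx y (- k) yX); rewrite E zpowN mulgK.
Qed.

Variable D : nat.
Hypothesis hypD : four_point S D.

(** The colour of [u] is the position of a [p] that obstructs it. If [p] obstructs both [u] and [v],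
    then [u q] and [v q] follow the geodesic to [p], hence each other; translating by [u^-1] costs
    the term [2 * L]. *)
Lemma fellow_coloring (E : seq G) k C L M q ps :
  (size ps <= k)%N -> (M + D + 2 * L <= C)%N ->
  (forall u : G, u \in E -> len u <= L)%N ->
  (forall u : G, len u <= C -> exists2 p : G, p \in ps &
     dist p (u * q)%g + C < len p + len (u * q)%g)%N ->
  exists c : G -> nat, (forall u : G, u \in E -> c u < k)%N /\
    forall u v : G, u \in E -> v \in E -> c u = c v -> fellow S q M (u^-1 * v)%g.
Proof.
move=> sps leC lE H.
have /choice[p hp] (u : G) : exists p : G, u \in E -> p \in ps /\
    (dist p (u * q)%g + C < len p + len (u * q)%g)%N.
  have [uE|_] := boolP (u \in E); last by exists u.
  have [|p pps hp] := H u; last by exists p.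
  by have := lE _ uE; glia.
exists (fun u => index (p u) ps); split=> [u /hp[pu _]|u v uE vE].
  by rewrite (leq_trans _ sps) // index_mem.
have [pu hu] := hp u uE; have [pv hv] := hp v vE => /(congr1 (nth 1%g ps)).
rewrite !nth_index // => puv; rewrite /fellow.
rewrite -[dist q _](wdistMl S u) !gmulA mulgV mul1g.
have := gromov_min symS genS hypD (u * q)%g (p u) (v * q)%g.
have := lenM u q; have := lenM u (u^-1 * v * q)%g; have := lE _ uE.
rewrite [dist (u * q)%g (p u)]wdistC // !gmulA mulgV mul1g; move: hu hv; rewrite puv.
glia.
Qed.

Lemma max_wordlen (E : seq G) : exists L, forall u : G, u \in E -> (len u <= L)%N.
Proof.
exists (\max_(u <- E) len u) => u uE.
by rewrite (big_rem u uE) /= leq_maxl.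
Qed.

(** One [u] serves [k] points at once: [k = 1] concatenates two elements, while larger [k] shows
    that spheres are unbounded. A failure for every [C] would give a [q] almost fixed by many
    elements: infinitely many directions cannot then fit in fibres of bounded size. *)
Lemma extension k : exists C, forall (ps : seq G) (q : G), (size ps <= k)%N ->
  exists u : G, (len u <= C)%N /\
    forall p, p \in ps -> (len p + len (u * q)%g <= dist p (u * q)%g + C)%N.
Proof.
apply: contrapT => /forallNP noext.
have {}noext C : exists ps q, (size ps <= k)%N /\
    forall u : G, (len u <= C -> exists2 p : G, p \in ps &
      dist p (u * q)%g + C < len p + len (u * q)%g)%N.
  have /existsNP[ps /existsNP[q /not_implyP[sps /forallNP H]]] := noext C.
  exists ps, q; split=> // u lu; have /not_andP[//|] := H u.
  by move=> /existsNP[p /not_implyP[pps /negP]]; rewrite -ltnNge; exists p.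
pose V0 := size (Defs.ball S (2 * (2 * D) + 5 * D)).
have [E0 [sE0 uE0 _]] := distinct_cosets 1%g (k * V0).+1.
(* The element [a] depends on [q], which exists only once [C] is fixed. So all candidates for [a],
   and coset representatives for each of them, are listed in advance, and [C] is chosen after their
   lengths. *)
pose A0 := [seq (u^-1 * v)%g | u <- E0, v <- E0].
have [A hA] := max_wordlen A0.
pose V1 := size (Defs.ball S (2 * (A + D) + 5 * D)).
have [X hX] := choice (fun a => distinct_cosets a (k * V1).+1).
pose E := E0 ++ flatten [seq X a | a <- A0].
have [LE hLE] := max_wordlen E.
pose l := (2 * LE)%N; pose L := (l + l * A)%N; pose N := (4 * L + 2 * A)%N.
pose M := (N + l * D + 2 * L + 2 * A + 4 * l)%N.
have [ps [q [sps /(fellow_coloring sps (leqnn (M + D + 2 * LE)) hLE)]]] :=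
  noext (M + D + 2 * LE)%N.
move=> [c [ck cfellow]].
have lE u v : u \in E -> v \in E -> (len (u^-1 * v)%g <= l)%N.
  move=> /hLE lu /hLE lv; have := lenM u^-1%g v; rewrite lenV /l; glia.
(* Among more than [V0] elements of one colour some quotient has displacement beyond [2 * D];
   otherwise all quotients would lie in one fibre. *)
have [a aA0 [fa ha]] : exists2 a, a \in A0 & fellow S q M a /\
    ((len q + 2 * D < len (a * q)%g)%N || (len (a * q)%g + 2 * D < len q)%N).
  have E0E (u : G) : u \in E0 -> u \in E by rewrite mem_cat => ->.
  have [|i] := monochromatic (m := V0) (fun x xE => ck x (E0E x xE)).
    by rewrite sE0.
  set W := [seq x <- E0 | _]; have uW : uniq W by exact: filter_uniq.
  have WE u : u \in W -> u \in E0 /\ c u = i by rewrite mem_filter => /andP[/eqP].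
  case: W uW WE => // u W uW WE lt_W; apply: contrapT => noa.
  move: lt_W; rewrite ltnNge => /negP; apply.
  rewrite -(size_map (fun v => u^-1 * v)%g) /V0.
  have [uE0' cu] := WE u (mem_head _ _).
  apply: (@fellow_fibre _ _ symS genS _ hypD q M l).
  - by rewrite map_inj_uniq //; exact: mulgI.
  - by rewrite /M; lia.
  move=> _ /mapP[/= v /WE[vE0 cv] ->].
  have fv : fellow S q M (u^-1 * v)%g.
    by apply: cfellow; rewrite ?E0E // cu cv.
  have /orP : ~~ ((len q + 2 * D < len (u^-1 * v * q)%g)%N
               || (len (u^-1 * v * q)%g + 2 * D < len q)%N).
    apply/negP => h; apply: noa; exists (u^-1 * v)%g => //.
    by apply/allpairsP; exists (u, v).
  have := lE u v (E0E _ uE0') (E0E _ vE0) => luv hv.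
  by split=> //; move: hv; glia.
have XE (u : G) : u \in X a -> u \in E.
  move=> uX; rewrite mem_cat; apply/orP; right; apply/flattenP.
  by exists (X a) => //; apply/mapP; exists a.
have [sXa uXa cosX] := hX a.
have [|i] := monochromatic (m := V1) (fun x xE => ck x (XE x xE)).
  by rewrite sXa.
set W := [seq x <- X a | _]; have uW : uniq W by exact: filter_uniq.
have WE u : u \in W -> u \in X a /\ c u = i by rewrite mem_filter => /andP[/eqP].
case: W uW WE => // u W uW WE lt_W.
move: lt_W; rewrite ltnNge => /negP; apply.
have [uX cu] := WE u (mem_head _ _).
(* More than [V1] quotients are brought into one fibre by powers of [a]. They stay distinct because
   the [v] lie in distinct cosets of the powers of [a], which contradicts the bound on the fibre. *)
have red (v : G) : exists j : int, v \in u :: W ->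
    let y := (u^-1 * v * zpow a j)%g in
    [/\ (len y <= L)%N, fellow S q N y, (len (y * q)%g <= len q + (A + D))%N
      & (len q <= len (y * q)%g + (A + D))%N].
  have [/WE[vX cv]|_] := boolP (v \in u :: W); last by exists 0.
  have fv : fellow S q M (u^-1 * v)%g by apply: cfellow; rewrite ?XE // cu cv.
  have luv := lE u v (XE _ uX) (XE _ vX).
  have := lenM (u^-1 * v)%g q; have := len_mul_ge symS genS (u^-1 * v)%g q => h1 h2.
  have [||||||||j hj] := @fellow_reduce _ _ symS genS _ hypD q A L N a l (u^-1 * v)%g; last by exists j.
  - exact: hA.
  - by apply: fellowW fa; rewrite /M; lia.
  - by rewrite /N; lia.
  - exact: ha.
  - by glia.
  - by glia.
  - by rewrite /L; glia.
  - by apply: fellowW fv; rewrite /M; lia.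
have [j hj] := choice red.
rewrite -(size_map (fun v => u^-1 * v * zpow a (j v))%g) /V1.
apply: (@fellow_fibre _ _ symS genS _ hypD q N L).
- rewrite map_inj_in_uniq // => v w /WE[vX _] /WE[wX _].
  rewrite -!mulgA => /mulgI E1; apply: (cosX _ _ (j w - j v) vX wX).
  by rewrite zpowD zpowN gmulA -E1 mulgK.
- by rewrite /N; lia.
by move=> _ /mapP[/= v vW ->]; exact: hj.
Qed.

End ExtensionLemma.

(** * Exponential bounds along multiples and the growth rate *)

Section ExponentialComparison.
Variable R : realType.
Implicit Types (B M r lam : R).

Lemma exp_comparison B M r : 0 <= B -> 0 < r ->
  (\forall k \near \oo, r ^+ k <= M * B ^+ k) -> r <= B.
Proof.
move=> B0 r0 H; rewrite leNgt; apply/negP => ltBr.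
have M0 : 0 < `|M| + 1 by rewrite ltr_pwDr.
have q1 : `|B / r| < 1.
  by rewrite ger0_norm ?divr_ge0 ?(ltW r0) // ltr_pdivrMr // mul1r.
have /cvgrPdist_lt/(_ _ (divr_gt0 ltr01 M0)) := cvg_expr q1.
move=> small; near \oo => k.
have : `|0 - (B / r) ^+ k| < 1 / (`|M| + 1) by near: k.
rewrite sub0r normrN ger0_norm; last by rewrite exprn_ge0 ?divr_ge0 ?(ltW r0).
rewrite ltr_pdivlMr // expr_div_n mulrAC ltr_pdivrMr ?exprn_gt0 // mul1r.
apply/negP; rewrite -leNgt (@le_trans _ _ (M * B ^+ k)) //; first by near: k.
by rewrite mulrC ler_wpM2l ?exprn_ge0 // (le_trans (ler_norm _)) // lerDl.
Unshelve. all: by end_near. Qed.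

Variables (u : nat -> nat) (lam : R).
Hypothesis u_lam : (fun n : nat => ((u n)%:R : R) `^ n%:R^-1) @ \oo --> lam.

Lemma growth_ge0 : 0 <= lam.
Proof.
apply: (cvgr_to_ge u_lam).
by near=> n; exact: powR_ge0.
Unshelve. all: by end_near. Qed.

(** For positive [n] and [k] this is the [k]-th root of [u (n * k)]. It tends to [lam ^+ n], so
    bounds along the multiples of a fixed [n] suffice. *)
Let block n k := (((u (n * k))%:R : R) `^ (n * k)%:R^-1) ^+ n.

Let cvg_block n : (0 < n)%N -> block n @ \oo --> lam ^+ n.
Proof.
move=> n0; pose v k := ((u (n * k))%:R : R) `^ (n * k)%:R^-1.
apply: (@continuous_cvg _ _ _ _ _ v (fun x : R => x ^+ n) lam).
  exact: exprn_continuous.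
exact: (cvg_comp _ _ (@cvg_mulnl n n0) u_lam).
Qed.

Let block_ge0 n k : 0 <= block n k.
Proof. exact/exprn_ge0/powR_ge0. Qed.

Let blockX n k : (0 < n)%N -> (0 < k)%N -> block n k ^+ k = (u (n * k))%:R.
Proof.
move=> n0 k0; rewrite -exprM -powR_mulrn ?powR_ge0 // -powRrM mulVf ?powRr1 //.
by rewrite pnatr_eq0 muln_eq0 negb_or -!lt0n n0.
Qed.

Lemma growth_le n B M : (0 < n)%N -> 0 <= B ->
  (forall k, (u (n * k))%:R <= M * B ^+ k) -> lam ^+ n <= B.
Proof.
move=> n0 B0 H; rewrite leNgt; apply/negP => ltB.
pose r := (B + lam ^+ n) / 2; have [ltBr ltr] := midf_lt ltB.
have : r <= B.
  apply: (@exp_comparison _ M) => //; first exact: le_lt_trans ltBr.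
  have r_le := cvgr_ge _ (cvg_block n0) _ ltr.
  near=> k; have k0 : (0 < k)%N by near: k; exact: nbhs_infty_gt.
  have rb : r <= block n k by near: k; exact: r_le.
  apply: le_trans (H k); rewrite -blockX // lerXn2r ?nnegrE //.
  by rewrite (le_trans B0) // ltW.
by rewrite leNgt ltBr.
Unshelve. all: by end_near. Qed.

Lemma growth_ge n B M : (0 < n)%N -> 0 <= B -> 0 <= M ->
  (forall k, B ^+ k <= M * (u (n * k))%:R) -> B <= lam ^+ n.
Proof.
move=> n0 B0 M0 H; rewrite leNgt; apply/negP => ltB.
pose r := (lam ^+ n + B) / 2; have [ltlr ltrB] := midf_lt ltB.
have r0 : 0 <= r by rewrite (le_trans _ (ltW ltlr)) // exprn_ge0 // growth_ge0.
have : B <= r.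
  apply: (@exp_comparison _ M) => //; first exact: le_lt_trans ltrB.
  have le_r := cvgr_le _ (cvg_block n0) _ ltlr.
  near=> k; have k0 : (0 < k)%N by near: k; exact: nbhs_infty_gt.
  have rb : block n k <= r by near: k; exact: le_r.
  by apply: le_trans (H k) _; rewrite ler_wpM2l // -blockX // lerXn2r ?nnegrE.
by rewrite leNgt ltrB.
Unshelve. all: by end_near. Qed.

End ExponentialComparison.

(** * Spheres have size comparable with powers of the growth rate *)

Section SphereGrowth.
Variables (G : groupType) (S : seq G).
Hypotheses (symS : symmetric_gen S) (genS : generates S) (neG : non_elementary G).
Variable D : nat.
Hypothesis hypD : four_point S D.
Local Notation len := (wordlen S).
Local Notation dist := (wdist S).
Local Notation lenM := (wordlenM genS).
Local Notation lenV := (wordlenV symS genS).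
Local Notation a := (fun n => size (sphere S n)).

Lemma prefix_choice : exists pre : nat -> G -> G, forall n g,
  len (pre n g) = minn n (len g) /\ (dist (pre n g) g + minn n (len g) = len g)%N.
Proof.
have /choice[f hf] (ng : nat * G) : exists p, len p = minn ng.1 (len ng.2) /\
    (dist p ng.2 + minn ng.1 (len ng.2) = len ng.2)%N.
  by apply: geodesic_point => //; rewrite geq_minr.
by exists (fun n g => f (n, g)) => n g; exact: (hf (n, g)).
Qed.

(** An element is determined by its prefix of length [n] and the remainder. *)
Lemma sphere_submul n m : (a (n + m) <= a n * a m)%N.
Proof.
have [pre hpre] := prefix_choice.
rewrite -(size_allpairs pair).
have inj : {in sphere S (n + m) &, injective (fun g : G => (pre n g, (pre n g)^-1 * g)%g)}.
  by move=> g h _ _ [-> /mulgI].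
rewrite -(size_map (fun g : G => (pre n g, (pre n g)^-1 * g)%g)).
apply: uniq_leq_size; first by rewrite map_inj_in_uniq ?sphere_uniq.
move=> _ /mapP[g + ->]; rewrite mem_sphere // => /eqP lg.
have [h1 h2] := hpre n g.
apply/allpairsP; exists (pre n g, (pre n g)^-1 * g)%g; split=> //=.
  by rewrite mem_sphere // h1 lg; apply/eqP; lia.
by rewrite mem_sphere // -/(wdist S _ _); apply/eqP; lia.
Qed.

(** Send [(g, h)] to the prefix of length [n + m - 2 * C] of [x = g u h]. One [C] is lost in the
    joining and one because [|u h|] may be less than [|h|], so [|x|] lies between [n + m - 2 * C]
    and [n + m + C]. The remainder of length at most [3 * C] gives back [x]; the prefix of [x] of
    length [n] is within [C + D] of [g]; and [u] then yields [h]. The multiplicity is thus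
    bounded. *)
Lemma sphere_supmul : exists c K : nat, forall n m, (c <= n + m)%N ->
  (a n * a m <= K * a (n + m - c))%N.
Proof.
have [pre hpre] := prefix_choice.
have [C hC] := extension symS genS neG hypD 1.
have /choice[u hu] (gh : G * G) : exists u, (len u <= C)%N /\
    (len gh.1 + len (u * gh.2)%g <= len (gh.1 * u * gh.2)%g + C)%N.
  have [u [lu H]] := hC [:: gh.1^-1%g] gh.2 isT.
  exists u; split=> //; have := H gh.1^-1%g (mem_head _ _).
  by rewrite lenV /wdist invgK gmulA.
exists (2 * C)%N.
exists (size (Defs.ball S (3 * C)) * (size (Defs.ball S (C + D)) * size (Defs.ball S C)))%N.
move=> n m le_nm; set N := (n + m - 2 * C)%N.
pose E := [seq (g, h) | g <- sphere S n, h <- sphere S m].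
pose F := [seq (y, zbu) | y <- sphere S N, zbu <- [seq (z, bu) |
  z <- Defs.ball S (3 * C), bu <- [seq (b, u) |
  b <- Defs.ball S (C + D), u <- Defs.ball S C]]].
have sF : size F = (size (Defs.ball S (3 * C)) *
   (size (Defs.ball S (C + D)) * size (Defs.ball S C)) * a N)%N.
  by rewrite mulnC !size_allpairs.
rewrite -sF -(size_allpairs pair) -/E.
pose x (gh : G * G) : G := (gh.1 * u gh * gh.2)%g.
pose f gh : G * (G * (G * G)) :=
  (pre N (x gh), ((pre N (x gh))^-1 * x gh, ((pre n (x gh))^-1 * gh.1, u gh)))%g.
have finj : injective f.
  move=> [g h] [g' h'] [E1 + + E4]; rewrite E1 => /mulgI E2.
  rewrite E2 => /mulgI /= E3; congr pair => //.
  by apply: (@mulgI _ (g * u (g, h))%g); rewrite {2}E4 {3}E3; exact: E2.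
rewrite -(size_map f); apply: uniq_leq_size.
  rewrite (map_inj_uniq finj) allpairs_uniq ?sphere_uniq //.
  by move=> [? ?] [? ?] _ _ [-> ->].
have key (g h : G) : len g = n -> len h = m ->
    [/\ len (pre N (x (g, h))) = N, (dist (pre N (x (g, h))) (x (g, h)) <= 3 * C)%N
      & (dist (pre n (x (g, h))) g <= C + D)%N].
  move=> lg lh; have [lu hgh] := hu (g, h); rewrite /= in hgh.
  have lx1 := lenM (g * u (g, h))%g h; have lx2 := lenM g (u (g, h)).
  have lx3 := len_mul_ge symS genS (u (g, h)) h.
  have dgx : dist g (x (g, h)) = len (u (g, h) * h)%g by rewrite /x -gmulA wdistMr.
  have := hpre N (x (g, h)); have := hpre n (x (g, h)).
  have := gromov_min symS genS hypD (pre n (x (g, h))) (x (g, h)) g.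
  rewrite [dist (x (g, h)) g]wdistC // dgx.
  have xE : x (g, h) = (g * u (g, h) * h)%g by [].
  rewrite -xE in lx1 hgh; rewrite /N; clear -lu hgh lx1 lx2 lx3 lg lh le_nm.
  by move=> h1 [h2 h3] [h4 h5]; split; glia.
move=> _ /mapP[_ /allpairsP[[g h] /= [+ + ->]] ->].
rewrite !mem_sphere // => /eqP lg /eqP lh; have [h1 h2 h3] := key g h lg lh.
apply/allpairsP; exists (f (g, h)); split=> //; first by rewrite mem_sphere //= h1.
apply/allpairsP; exists (f (g, h)).2; split=> //; first by rewrite mem_wball.
apply/allpairsP; exists (f (g, h)).2.2; split=> //; first by rewrite mem_wball.
by rewrite mem_wball //; have [] := hu (g, h).
Qed.

Lemma sphere_gt0 n : (0 < a n)%N.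
Proof.
suff [g lg] : exists g, (n <= len g)%N.
  have [pre hpre] := prefix_choice; have [h1 _] := hpre n g.
  have : pre n g \in sphere S n by rewrite mem_sphere // h1; apply/eqP/minn_idPl.
  by case: (sphere S n).
apply: contrapT => /forallNP noG; apply: neG; exists 1%g, (Defs.ball S n) => x.
have /negP := noG x; rewrite -ltnNge => lx.
by exists x; [rewrite mem_wball // ltnW|exists 0; rewrite zpow0 mulg1].
Qed.

(** If the sphere of radius [C + 1] had at most [k] points, some [u q] would have product at most
    [C] with all of them; but the prefix of [u q] on this sphere has doubled product [2 * (C + 1)]
    with it. *)
Lemma sphere_unbounded k : exists n, (k < a n)%N.
Proof.
apply: contrapT => /forallNP bnd; have [C hC] := extension symS genS neG hypD k.
pose n := C.+1; have [pre hpre] := prefix_choice.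
have [q lq] : exists q, (n + C <= len q)%N.
  have := sphere_gt0 (n + C); case E : (sphere S (n + C)) => [|q s] // _.
  by exists q; have := mem_sphere genS (n + C) q; rewrite E mem_head => /esym/eqP->.
have [|u [lu H]] := hC (sphere S n) q; first by rewrite leqNgt; apply/negP/bnd.
have luq := len_mul_ge symS genS u q; have [h1 h2] := hpre n (u * q)%g.
have /H : pre n (u * q)%g \in sphere S n.
  by rewrite mem_sphere // h1; apply/eqP; move: luq lq lu; rewrite /n; glia.
by rewrite /n in h1 h2 *; glia.
Qed.

Variables (R : realType) (lam : R).
Hypothesis lamP : growth_rate S lam.
Local Notation s n := ((size (sphere S n))%:R : R).

(** Fekete's argument: submultiplicativity bounds the spheres of radius [n * k] by the [k]-th power
    of that of radius [n]. *)
Lemma sphere_ge n : lam ^+ n <= s n.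
Proof.
have [->|n0] := posnP n; first by rewrite expr0 ler1n sphere_gt0.
apply: (@growth_le _ _ _ lamP n _ (s 0)) => // k.
rewrite -natrX -natrM ler_nat; elim: k => [|k IH]; first by rewrite muln0 muln1.
by rewrite mulnS expnS mulnCA (leq_trans (sphere_submul _ _)) // leq_mul2l IH orbT.
Qed.

(** Iterated almost supermultiplicativity gives [a (n + c) <= K * lam ^+ n] for positive [n]. If
    [lam] were 1, the spheres would be bounded. *)
Lemma sphere_growth : 1 < lam /\ exists C : R, forall n, s n <= C * lam ^+ n.
Proof.
have [c [K hK]] := sphere_supmul.
have lam1 : 1 <= lam.
  rewrite -(expr1 lam); apply: (@growth_ge _ _ _ lamP 1 _ 1) => // k.
  by rewrite expr1n mul1r mul1n ler1n sphere_gt0.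
have K0 : (0 < K)%N.
  rewrite lt0n; apply/eqP => K0; have := hK c c (leq_addr _ _).
  by rewrite K0 mul0n leqNgt muln_gt0 !sphere_gt0.
have power n k : (a (n + c) ^ k <= K ^ k * a (n * k + c))%N.
  elim: k => [|k IH]; first by rewrite muln0 mul1n sphere_gt0.
  rewrite !expnS (leq_trans (leq_mul (leqnn _) IH)) // mulnCA [(K * _)%N]mulnC -mulnA.
  rewrite leq_mul2l; apply/orP; right.
  by have := hK (n + c)%N (n * k + c)%N; rewrite mulnS addnACA addnA addnK; apply; lia.
have KR0 : 0 < K%:R :> R by rewrite ltr0n.
have root n : (0 < n)%N -> s (n + c) / K%:R <= lam ^+ n.
  move=> n0; apply: (@growth_ge _ _ _ lamP n _ (s c)) => [//||//|k].
    by rewrite divr_ge0.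
  rewrite expr_div_n ler_pdivrMr ?exprn_gt0 // -!natrX -!natrM ler_nat.
  apply: leq_trans (power n k) _; rewrite mulnC leq_mul2r; apply/orP; right.
  by rewrite [leqRHS]mulnC; exact: sphere_submul.
split.
  rewrite lt_neqAle lam1 andbT; apply/eqP => lam_eq1.
  (* The sum over the first spheres forces [c < n0]. *)
  pose bound := (2 * K + \sum_(i < c.+1) a i)%N.
  have [n0 lt_n0] := sphere_unbounded bound.
  have ltc : (c < n0)%N.
    rewrite ltnNge; apply/negP => le_c; move: lt_n0; apply/negP; rewrite -leqNgt.
    by rewrite /bound (bigD1 (Ordinal (le_c : n0 < c.+1)%N)) //= addnCA leq_addr.
  have n1 : (0 < n0 - c)%N by rewrite subn_gt0.
  have := root _ n1; rewrite (subnK (ltnW ltc)).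
  rewrite -lam_eq1 expr1n ler_pdivrMr // mul1r ler_nat leqNgt => /negP; apply.
  by rewrite (leq_trans _ lt_n0) // ltnS /bound mul2n -addnn -addnA leq_addr.
exists (K%:R + (\sum_(i < c.+1) a i)%:R) => n.
have lamX m : 1 <= lam ^+ m by rewrite exprn_ege1.
have [ltc|le_c] := ltnP c n.
  apply: (@le_trans _ _ (K%:R * lam ^+ n)); last first.
    by rewrite ler_wpM2r ?lerDl // (le_trans ler01).
  have n1 : (0 < n - c)%N by rewrite subn_gt0.
  have := root _ n1; rewrite (subnK (ltnW ltc)).
  rewrite ler_pdivrMr // mulrC => /le_trans; apply.
  by rewrite ler_wpM2l ?(ltW KR0) // ler_weXn2l ?leq_subr // ltW.
apply: (@le_trans _ _ (K%:R + (\sum_(i < c.+1) a i)%:R)).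
  rewrite -natrD ler_nat (bigD1 (Ordinal (le_c : n < c.+1)%N)) //=.
  by rewrite addnCA leq_addr.
by rewrite ler_peMr // -natrD.
Qed.

End SphereGrowth.

(** * Boundary and shadows *)

Section BoundaryAction.
Variables (G : groupType) (S : seq G).
Hypotheses (symS : symmetric_gen S) (genS : generates S).
Local Notation len := (wordlen S).
Local Notation dist := (wdist S).
Local Notation X := (compactification S).

Lemma bpoint_eq (xi eta : bpoint S) : bclass xi = bclass eta -> xi = eta.
Proof.
by case: xi eta => [c p] [c' p'] /= E; subst c'; rewrite (Prop_irrelevance p p').
Qed.

Lemma ray_equiv_refl r : ray_equiv S r r.
Proof. by exists 0%N => n; rewrite wdistxx. Qed.

Lemma bclassP (xi : bpoint S) r r' :
  bclass xi r -> bclass xi r' <-> geodesic_ray S r' /\ ray_equiv S r r'.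
Proof.
have [r0 [g0 ->]] := bclass_ok xi => -[/= gr [C hC]].
split=> [[gr' [C' hC']]|[gr' [C' hC']]]; split=> //; exists (C + C')%N => n.
  apply: leq_trans (wdist_triangle genS (r0 n) _ _) _.
  by rewrite leq_add // wdistC.
apply: leq_trans (wdist_triangle genS (r n) _ _) _.
by rewrite leq_add.
Qed.

Lemma bclass_ray (xi : bpoint S) r : bclass xi r -> geodesic_ray S r.
Proof. by have [r0 [_ ->]] := bclass_ok xi => -[]. Qed.

Definition translate_class (g : G) (c : set (nat -> G)) : set (nat -> G) :=
  [set r | c (fun n => g^-1 * r n)%g].

Lemma translate_class_ok g (xi : bpoint S) :
  exists r, geodesic_ray S r /\
    translate_class g (bclass xi) = [set r' | geodesic_ray S r' /\ ray_equiv S r r'].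
Proof.
have [r [gr ->]] := bclass_ok xi; exists (fun n => g * r n)%g; split.
  by move=> n m; rewrite wdistMl; exact: gr.
apply/seteqP; split=> r' /= [gr' [C hC]]; split.
- by move=> n m /gr'; rewrite wdistMl.
- by exists C => n; rewrite -(wdistMl S g^-1%g) mulKg.
- by move=> n m; rewrite wdistMl; exact: gr'.
- by exists C => n; rewrite -(wdistMl S g) mulVKg.
Qed.

Definition bact (g : G) (xi : bpoint S) : bpoint S :=
  BPoint (translate_class_ok g xi).

Definition cact (g : G) (x : X) : X :=
  match x with Pt h => Pt S (g * h)%g | Bd xi => Bd (bact g xi) end.

Lemma represents_cact (g : G) (x : X) a :
  represents x a -> represents (cact g x) (fun n => g * a n)%g.
Proof.
case: x => [h /= ah n|xi /= xia]; first by rewrite ah.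
by rewrite /translate_class /=; under eq_fun do rewrite mulKg.
Qed.

Lemma cactM (g h : G) (x : X) : cact (g * h)%g x = cact g (cact h x).
Proof.
case: x => [k|xi] /=; first by rewrite mulgA.
congr Bd; apply: bpoint_eq; apply/funext => r.
rewrite -[LHS]/(bclass xi (fun n => (g * h)^-1 * r n)%g).
rewrite -[RHS]/(bclass xi (fun n => h^-1 * (g^-1 * r n))%g); congr bclass.
by apply/funext => n; rewrite ginvM gmulA.
Qed.

Lemma cact1 (x : X) : cact 1%g x = x.
Proof.
case: x => [k|xi] /=; first by rewrite mul1g.
congr Bd; apply: bpoint_eq; apply/funext => r.
rewrite -[LHS]/(bclass xi (fun n => 1^-1 * r n)%g); congr bclass.
by apply/funext => n; rewrite invg1 mul1g.
Qed.

Lemma cactK g : cancel (cact g) (cact g^-1%g).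
Proof. by move=> x; rewrite -cactM mulVg cact1. Qed.

Lemma represents_ex (x : X) : exists a, represents x a.
Proof.
case: x => [h|xi]; first by exists (fun=> h).
have [r [gr E]] := bclass_ok xi; exists r; rewrite /= E; split=> //.
exact: ray_equiv_refl.
Qed.

Variable D : nat.
Hypothesis hypD : four_point S D.
Local Notation gmin := (gromov_min symS genS hypD).
Local Notation lenM := (wordlenM genS).
Local Notation lenV := (wordlenV symS genS).

(** The doubled product of [g] with itself is only [2 * len g]; the equality alternative makes the
    relation reflexive for every [t], as is required at the isolated points of the
    compactification. *)
Definition gclose (t : nat) (g h : G) : Prop :=
  g = h \/ (dist g h + t <= len g + len h)%N.

Lemma gcloseW t t' g h : (t' <= t)%N -> gclose t g h -> gclose t' g h.
Proof. by move=> le_t [->|H]; [left|right; lia]. Qed.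

Lemma gcloseC t g h : gclose t g h -> gclose t h g.
Proof. by case=> [->|H]; [left|right; rewrite wdistC // addnC; lia]. Qed.

Lemma gclose_trans t (g h k : G) : gclose (t + D) g h -> gclose (t + D) h k -> gclose t g k.
Proof.
move=> [->|H]; first by apply: gcloseW; lia.
move=> [<-|H']; first by right; lia.
by right; have := gmin g h k; lia.
Qed.

Lemma gclose_mul t (g h k : G) : gclose (t + 2 * len g) h k -> gclose t (g * h)%g (g * k)%g.
Proof.
move=> [->|H]; [by left|right]; rewrite wdistMl.
have := len_mul_ge symS genS g h; have := len_mul_ge symS genS g k; lia.
Qed.

(* Two sequences representing [x] and [y] eventually have (doubled) Gromov
   product at least [t], or are equal. *)
Definition eventually_close t (a b : nat -> G) :=
  exists N, forall i j, (N <= i)%N -> (N <= j)%N -> gclose t (a i) (b j).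

Lemma geodesic_ray_len r n : geodesic_ray S r -> (n <= len (r n) + len (r 0%N))%N.
Proof.
move=> /(_ 0%N n (leq0n n)); rewrite subn0 => E; rewrite -{1}E.
by have := wdist_triangle genS 1%g (r 0%N) (r n); rewrite wdist1g wdistg1 // addnC.
Qed.

Lemma represents_close (x : X) a b t :
  represents x a -> represents x b -> eventually_close t a b.
Proof.
case: x => [h ah bh|xi xa xb]; first by exists 0%N => i j _ _; left; rewrite ah bh.
have [gb [C hC]] := (bclassP b xa).1 xb; have ga := bclass_ray xa.
exists (t + C + len (a 0%N) + len (b 0%N))%N => i j Ni Nj; right.
have la := geodesic_ray_len i ga; have lb := geodesic_ray_len j gb.
have := wdist_triangle genS (b i) (a i) (b j); have := hC i.
have [ij|/ltnW ji] := leqP i j; first by rewrite (gb _ _ ij); lia.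
by rewrite [dist (b i) _]wdistC // (gb _ _ ji); lia.
Qed.

Definition bnear (t : nat) (x y : X) : Prop :=
  exists a b, [/\ represents x a, represents y b & eventually_close t a b].

Lemma bnear_refl t x : bnear t x x.
Proof.
have [a xa] := represents_ex x; exists a, a; split=> //; exact: (represents_close _ xa xa).
Qed.

Lemma bnearC t x y : bnear t x y -> bnear t y x.
Proof.
move=> [a [b [xa yb [N H]]]]; exists b, a; split=> //.
by exists N => i j Ni Nj; apply/gcloseC/H.
Qed.

Lemma bnearW t t' x y : (t' <= t)%N -> bnear t x y -> bnear t' x y.
Proof.
move=> le_t [a [b [xa yb [N H]]]]; exists a, b; split=> //.
by exists N => i j Ni Nj; exact/(gcloseW le_t)/H.
Qed.

Lemma eventually_close_trans t a b c :
  eventually_close (t + D) a b -> eventually_close (t + D) b c -> eventually_close t a c.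
Proof.
move=> [N H] [N' H']; exists (maxn N N') => i j; rewrite !geq_max.
move=> /andP[Ni N'i] /andP[Nj N'j].
by apply: (@gclose_trans _ _ (b (maxn N N'))); [apply: H|apply: H'];
  rewrite // ?leq_maxl ?leq_maxr.
Qed.

(** Passing from some representatives to given ones costs [D] for each of the two points. *)
Lemma bnear_represents t x y a b :
  bnear (t + 2 * D) x y -> represents x a -> represents y b -> eventually_close t a b.
Proof.
move=> [a' [b' [xa' yb' H]]] xa yb.
apply: (@eventually_close_trans _ _ a'); first exact: (represents_close _ xa xa').
apply: (@eventually_close_trans _ _ b'); last exact: (represents_close _ yb' yb).
by rewrite -addnA addnn -mul2n.
Qed.

Lemma bnear_trans t x y z : bnear (t + 3 * D) x y -> bnear (t + 3 * D) y z -> bnear t x z.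
Proof.
move=> [a [b [xa yb H]]] nyz; have [c zc] := represents_ex z.
exists a, c; split=> //; apply: (@eventually_close_trans _ _ b).
  by case: H => N H; exists N => i j Ni Nj; apply: gcloseW (H _ _ Ni Nj); lia.
by apply: (bnear_represents _ yb zc); apply: bnearW nyz; lia.
Qed.

Lemma bnear_cact t (g : G) x y : bnear (t + 2 * len g) x y -> bnear t (cact g x) (cact g y).
Proof.
move=> [a [b [xa yb [N H]]]].
exists (fun n => g * a n)%g, (fun n => g * b n)%g.
split; [exact: represents_cact|exact: represents_cact|].
by exists N => i j Ni Nj; exact/gclose_mul/H.
Qed.

(* [g] lies within [R / 2] of the geodesics from [1] to [x]. *)
Definition shadow (R : nat) (g : G) (x : X) : Prop :=
  exists2 b, represents x b &
    exists N, forall j, (N <= j)%N -> (dist g (b j) + len g <= len (b j) + R)%N.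

Lemma shadowW R R' g x : (R <= R')%N -> shadow R g x -> shadow R' g x.
Proof. by move=> le_R [b xb [N H]]; exists b => //; exists N => j /H; lia. Qed.

Lemma shadow_step R (g h k : G) : (dist g h + len g <= len h + R)%N ->
  gclose (2 * len g) h k -> (dist g k + len g <= len k + (R + D))%N.
Proof. by move=> H [<-|H']; [lia|have := gmin g h k; lia]. Qed.

Lemma shadow_close R g x b a : shadow R g x -> represents x b ->
  eventually_close (2 * len g) b a ->
  exists N, forall j, (N <= j)%N -> (dist g (a j) + len g <= len (a j) + (R + 2 * D))%N.
Proof.
move=> [b0 xb0 [N0 H0]] xb [N1 H1].
have [N2 H2] := represents_close (2 * len g) xb0 xb.
pose i := maxn N0 (maxn N1 N2); exists i => j ij.
have hb : (dist g (b i) + len g <= len (b i) + (R + D))%N.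
  by apply: shadow_step (H0 i _) (H2 i i _ _); rewrite /i; lia.
by have := shadow_step hb (H1 i j _ _); rewrite -addnA addnn -mul2n; apply; rewrite /i in ij *; lia.
Qed.

Lemma shadow_represents R g x a : shadow R g x -> represents x a ->
  exists N, forall j, (N <= j)%N -> (dist g (a j) + len g <= len (a j) + (R + 2 * D))%N.
Proof.
by move=> sx xa; apply: (shadow_close sx xa); exact: (represents_close _ xa xa).
Qed.

Lemma shadow_near R g x y : shadow R g x -> bnear (2 * len g) x y -> shadow (R + 2 * D) g y.
Proof.
move=> sx [a [b [xa yb ab]]]; exists b => //; exact: (shadow_close sx xa ab).
Qed.

(** Shadows shrink: two points whose geodesics pass near [g] have product about [2 * len g]. This
    makes windows at large times fit into open sets. *)
Lemma bnear_shadow t R g x y : shadow R g x -> shadow R g y ->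
  (t + R + D <= 2 * len g)%N -> bnear t x y.
Proof.
move=> [a xa [N H]] [b yb [N' H']] le_t; exists a, b; split=> //.
exists (maxn N N') => i j; rewrite !geq_max => /andP[Ni _] /andP[_ Nj].
have := H i Ni; have := H' j Nj; have := gmin (a i) g (b j).
by rewrite [dist (a i) g]wdistC //; right; lia.
Qed.

(** The element is the prefix of length [k] of a far point of a representing ray; [D] pays for the
    passage to the later points of the ray. *)
Lemma shadow_ex (xi : bpoint S) k : exists2 g, len g = k & shadow D g (Bd xi).
Proof.
have [a xa] := represents_ex (Bd xi).
have [N H] := represents_close (2 * k) xa xa; have ra := bclass_ray xa.
pose i := (N + k + len (a 0%N))%N.
have [p [lp dp]] : exists p, len p = k /\ (dist p (a i) + k = len (a i))%N.
  by apply: geodesic_point => //; have := geodesic_ray_len i ra; rewrite /i; lia.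
exists p => //; exists a => //; exists N => j Nj.
have := shadow_step (g := p) (h := a i) (k := a j) (R := 0) _ (_ : gclose (2 * len p) _ _).
by apply; [lia|rewrite lp; apply: H => //; rewrite /i; lia].
Qed.

(** The two truncated differences add up to the absolute difference of the lengths: near a common
    geodesic, elements of almost equal length are close. *)
Lemma shadow_dist R R' g g' x : shadow R g x -> shadow R' g' x ->
  (dist g g' <= (len g - len g') + (len g' - len g) + maxn R R' + 3 * D)%N.
Proof.
move=> [b xb [N H]] /shadow_represents/(_ xb)[N' H'].
have := H (maxn N N') (leq_maxl _ _); have := H' (maxn N N') (leq_maxr _ _).
have := gmin g (b (maxn N N')) g'; rewrite [dist (b _) g']wdistC //; lia.
Qed.

Lemma shadow_pt R g h : shadow R g (Pt S h) -> (dist g h + len g <= len h + R)%N.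
Proof. by move=> [b /= hb [N /(_ N (leqnn N))]]; rewrite hb. Qed.

(** The recentred geodesic passes near [h], so the original one passes near [g] and then near [g h],
    and lengths almost add. The [2 * D] comes from using the translated representative in the second
    shadow. *)
Lemma shadow_mul R R' (g h : G) x :
  shadow R g x -> shadow R' h (cact g^-1%g x) ->
  shadow (R + R' + 2 * D) (g * h)%g x /\ (len g + len h <= len (g * h)%g + (R + R' + 2 * D))%N.
Proof.
move=> [b xb [N H]] sh.
have [N' H'] := shadow_represents sh (represents_cact g^-1%g xb).
have K j : (maxn N N' <= j)%N ->
    (dist (g * h)%g (b j) + len g + len h <= len (b j) + (R + R' + 2 * D))%N.
  rewrite geq_max => /andP[/H h1 /H']; rewrite -(wdistMl S g) mulVKg.
  by rewrite -/(wdist S g (b j)); lia.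
split.
  exists b => //; exists (maxn N N') => j /K; have := lenM g h; glia.
have := K _ (leqnn _); have := wdist_triangle genS (g * h)%g 1%g (b (maxn N N')).
by rewrite !wdist1g; glia.
Qed.

(* The points which [g] does not send to its shadow are close to [g^-1], hence
   lie in the shadow of a point of a geodesic from [1] to [g^-1]. *)
Lemma shadow_compl (g : G) n :
  (forall x, shadow (2 * n) g (cact g x)) \/
  exists2 p, len p = n &
    forall x, ~ shadow (2 * n) g (cact g x) -> shadow (2 * D) p x.
Proof.
have far x b : ~ shadow (2 * n) g (cact g x) -> represents x b -> forall N,
    exists2 j, (N <= j)%N & (len (g * b j)%g + 2 * n < len (b j) + len g)%N.
  move=> ns xb N; apply: contrapT => noj; apply: ns.
  exists (fun n => g * b n)%g; first exact: represents_cact.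
  exists N => j Nj; rewrite wdistMr leqNgt; apply/negP => lt_j.
  by apply: noj; exists j.
have [le_n|lt_n] := leqP n (len g); last first.
  left=> x; apply: contrapT => /far far_x; have [b xb] := represents_ex x.
  by have [j _] := far_x b xb 0%N; have := len_mul_ge symS genS g (b j); lia.
right; have [p [lp dp]] : exists p, len p = n /\ (dist p g^-1%g + n = len g^-1%g)%N.
  by apply: geodesic_point => //; rewrite lenV.
rewrite lenV in dp.
exists p => // x ns; have [b xb] := represents_ex x.
have [N H] := represents_close (2 * n) xb xb; have [j Nj hj] := far x b ns xb N.
have dgb : dist g^-1%g (b j) = len (g * b j)%g by rewrite /wdist invgK.
exists b => //; exists N => k Nk; rewrite mul2n -addnn.
apply: (@shadow_step D p (b j) (b k)); last by rewrite lp; exact: H.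
have := gmin p g^-1%g (b j); rewrite dgb lenV; lia.
Qed.

End BoundaryAction.

(** * The topology of the compactification as a uniform topology *)

Section BoundaryTopology.
Variables (G : groupType) (S : seq G).
Hypotheses (symS : symmetric_gen S) (genS : generates S).
Variable D : nat.
Hypothesis hypD : four_point S D.
Variable R : realType.
Local Notation len := (wordlen S).
Local Notation dist := (wdist S).
Local Notation X := (compactification S).

Lemma bnear_pt n g x : (2 * len g < n)%N -> bnear n (Pt S g) x -> x = Pt S g.
Proof.
move=> lt_n [a [b [/= ag xb [N H]]]].
have bg j : (N <= j)%N -> b j = g.
  move=> Nj; have := H N j (leqnn N) Nj; rewrite ag => -[//|].
  have := wdist_triangle genS g 1%g (b j); rewrite !wdist1g; lia.
case: x xb => [h /= bh|xi /= xib]; first by rewrite -(bg N) // bh.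
(* A geodesic ray cannot be eventually constant, since consecutive points are at distance 1. *)
have := bclass_ray xib (leqnSn N); rewrite !bg // wdistxx // subSnn.
by [].
Qed.

Lemma gprodE (g h : G) (t : R) : (t < gprod S R g h 1%g) =
  ((dist g h)%:R + t * 2 < (len g)%:R + (len h)%:R).
Proof. by rewrite /gprod !wdist1g // ltr_pdivlMr // ltrBrDl. Qed.

Lemma basic_nbhd_bnear (x : X) B : basic_nbhd R x B ->
  exists n, forall y, bnear n x y -> B y.
Proof.
case: x => [g /= ->|xi /= [t ->]].
  by exists (2 * len g).+1 => y; apply: bnear_pt.
pose n := Num.bound (2 * `|t|).
have lt_n : 2 * `|t| < n%:R by rewrite archi_boundP // mulr_ge0.
have lt_tn : t * 2 < n%:R.
  by rewrite (le_lt_trans _ lt_n) // mulrC ler_pM2l // ler_norm.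
exists n => y [a [b [xa yb [N H]]]]; exists a, b; split=> //; split=> //.
(* Waiting until [len (a i) >= n] covers the case of equal terms, where the product is just the
   length. *)
exists (maxn N (n + len (a 0%N))%N) => i j; rewrite !geq_max => /andP[Ni ni] /andP[Nj _].
rewrite gprodE; have [<-|le_n] := H i j Ni Nj; last first.
  by rewrite -natrD (lt_le_trans _ (_ : (dist (a i) (b j) + n)%:R <= _)) ?ler_nat // natrD ltrD2l.
rewrite wdistxx // add0r (lt_le_trans lt_tn) // -natrD ler_nat.
by have := geodesic_ray_len symS genS i (bclass_ray xa); lia.
Qed.

Lemma bnear_basic_nbhd (x : X) n :
  exists2 B, basic_nbhd R x B & forall y, B y -> bnear n x y.
Proof.
case: x => [g|xi] /=.
  by exists [set Pt S g] => // y ->; exact: bnear_refl.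
eexists; first by exists (n%:R / 2).
move=> y /= [a [b [xa [yb [N H]]]]]; exists a, b; split=> //; exists N => i j Ni Nj.
have := H i j Ni Nj; rewrite gprodE divfK ?pnatr_eq0 // -!natrD ltr_nat => /ltnW.
by right.
Qed.

Lemma open_setP (U : set X) :
  open_set R U <-> forall x, U x -> exists n, forall y, bnear n x y -> U y.
Proof.
split=> [oU x /oU[B [/basic_nbhd_bnear[n hn] BU]]|H x /H[n hn]].
  by exists n => y /hn/BU.
by have [B hB nB] := bnear_basic_nbhd x n; exists B; split=> // y /nB/hn.
Qed.

Lemma cont_funP (f : X -> R) :
  cont_fun f <-> forall x e, 0 < e -> exists n, forall y, bnear n x y -> `|f y - f x| < e.
Proof.
split=> [cf x e /(cf x)[B [/basic_nbhd_bnear[n hn] BU]]|H x e /(H x)[n hn]].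
  by exists n => y /hn/BU.
by have [B hB nB] := bnear_basic_nbhd x n; exists B; split=> // y /nB/hn.
Qed.

(** The relations [bnear n] are a base of a uniform structure: the loss [3 * D] in transitivity is
    absorbed by enlarging [n]. Urysohn functions for sets at positive uniform distance are then
    available. *)
Definition bnear_entourage : set_system (X * X) :=
  [set E | exists n, forall x y, bnear n x y -> E (x, y)].

Lemma bnear_entourage_filter : Filter bnear_entourage.
Proof.
split; first by exists 0%N.
  move=> P Q [n hn] [m hm]; exists (maxn n m) => x y nxy; split.
    by apply: hn; apply: bnearW nxy; rewrite leq_maxl.
  by apply: hm; apply: bnearW nxy; rewrite leq_maxr.
by move=> P Q PQ [n hn]; exists n => x y /hn/PQ.
Qed.

Lemma bnear_entourage_diagonal (E : set (X * X)) : bnear_entourage E -> diagonal `<=` E.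
Proof. by move=> [n hn] [x y] /diagonalP ->; apply/hn/bnear_refl. Qed.

Lemma bnear_entourage_inv (E : set (X * X)) :
  bnear_entourage E -> bnear_entourage (E^-1)%relation.
Proof. by move=> [n hn]; exists n => x y /(bnearC symS genS)/hn. Qed.

Lemma bnear_entourage_split (E : set (X * X)) : bnear_entourage E ->
  exists2 B, bnear_entourage B & (B \; B `<=` E)%relation.
Proof.
move=> [n hn]; exists [set xy | bnear (n + 3 * D) xy.1 xy.2]; first by exists (n + 3 * D)%N.
move=> [x z] /= [y xy yz]; apply: hn; exact: bnear_trans xy yz.
Qed.

Lemma boundary_urysohn (A B : set X) n :
  (forall x y, A x -> B y -> ~ bnear n x y) ->
  exists f : X -> R, [/\ cont_fun f, forall x, 0 <= f x <= 1,
    forall x, A x -> f x = 0 & forall x, B x -> f x = 1].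
Proof.
move=> AB.
pose U : uniformType := HB.pack X (isUniform.Build X bnear_entourage_filter
  bnear_entourage_diagonal bnear_entourage_inv bnear_entourage_split).
have sep : @uniform_separator U A B.
  apply: uniform_separatorW; exists [set xy | bnear n xy.1 xy.2]; first by exists n.
  by apply/seteqP; split=> // -[x y] /= [[Ax By] /AB]; exact.
exists (@Urysohn U R A B); split.
- apply/cont_funP => x e e0.
  have /(_ x) := @Urysohn_continuous U R A B.
  move=> /cvgrPdist_lt/(_ e e0)/nbhsP[E [m hm] HE]; exists m => y nxy.
  by rewrite distrC; apply: HE; apply/xsectionP/hm.
- move=> x; have := @Urysohn_range U R A B (@Urysohn U R A B x).
  by rewrite /= in_itv /=; apply; exists x.
- by move=> x Ax; apply: (Urysohn_sub0 sep); exists x.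
- by move=> x Bx; apply: (Urysohn_sub1 sep); exists x.
Qed.

End BoundaryTopology.

(** * Patterson-Sullivan measures *)

Section RealProbability.
Context (d : measure_display) (T : measurableType d) (R : realType).
Variable mu : probability T R.
Implicit Types A B : set T.

Definition prob A : R := fine (mu A).

Lemma probE A : measurable A -> mu A = (prob A)%:E.
Proof. by move=> mA; rewrite /prob fineK // fin_num_measure. Qed.

Lemma prob_ge0 A : 0 <= prob A.
Proof. exact: fine_ge0. Qed.

Lemma prob_le A B : measurable A -> measurable B -> A `<=` B -> prob A <= prob B.
Proof. by move=> mA mB AB; rewrite -lee_fin -!probE // le_measure ?inE. Qed.

Lemma probT : prob setT = 1.
Proof. by rewrite /prob probability_setT. Qed.

Lemma prob0 : prob set0 = 0.
Proof. by rewrite /prob measure0. Qed.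

Lemma prob_le1 A : measurable A -> prob A <= 1.
Proof. by move=> mA; rewrite -probT prob_le. Qed.

Lemma probDI A B : measurable A -> measurable B ->
  prob A = prob (A `\` B) + prob (A `&` B).
Proof.
move=> mA mB; apply: EFin_inj; rewrite EFinD -!probE //.
- exact: measureDI.
- exact: measurableI.
- exact: measurableD.
Qed.

Lemma probC A : measurable A -> prob (~` A) = 1 - prob A.
Proof. by move=> mA; rewrite -probT (probDI measurableT mA) setTD setTI addrK. Qed.

Lemma probU A B : measurable A -> measurable B -> prob (A `|` B) <= prob A + prob B.
Proof.
move=> mA mB; rewrite -lee_fin EFinD -!probE //; first exact: measureU2.
exact: measurableU.
Qed.

Lemma prob_vanish (F : (set T)^nat) : (forall n, measurable (F n)) ->
  (forall n, F n.+1 `<=` F n) -> (forall x, exists n, ~ F n x) ->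
  forall e, 0 < e -> exists n, prob (F n) < e.
Proof.
move=> mF dF F0 e e0.
have FI : \bigcap_n F n = set0.
  by apply/seteqP; split=> // x /= Fx; have [n] := F0 x; apply; exact: Fx.
have := @nonincreasing_cvg_mu _ T R mu F; rewrite FI measure0 => H.
have {H} : mu \o F @ \oo --> 0%E.
  apply: H => //.
  - exact: le_lt_trans (probability_le1 mu (mF 0%N)) (ltry 1).
  - by apply/nonincreasing_seqP => n; apply/subsetPset/dF.
move/fine_cvgP => [_ /cvgrPdist_lt/(_ e e0)[N _ /(_ N (leqnn N))]] /=.
rewrite sub0r normrN => H; exists N; apply: le_lt_trans H.
exact: ler_norm.
Qed.

(** Integration of a pointwise comparison of counts; it turns bounded multiplicity and covering
    statements into inequalities between sums of probabilities. *)
Lemma prob_sum_le (I J : Type) (s : seq I) (t : seq J) (A : I -> set T)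
    (B : J -> set T) (c : R) : 0 <= c ->
  (forall i, measurable (A i)) -> (forall j, measurable (B j)) ->
  (forall x, \sum_(i <- s) \1_(A i) x <= c * \sum_(j <- t) \1_(B j) x) ->
  \sum_(i <- s) prob (A i) <= c * \sum_(j <- t) prob (B j).
Proof.
move=> c0 mA mB le_AB.
have intE (K : Type) (u : seq K) (C : K -> set T) : (forall k, measurable (C k)) ->
    (\int[mu]_x (\sum_(k <- u) \1_(C k) x)%:E = (\sum_(k <- u) prob (C k))%:E)%E.
  move=> mC; under eq_integral do rewrite -sumEFin.
  rewrite ge0_integral_sum //.
  - rewrite -sumEFin; apply: eq_bigr => k _.
    by rewrite integral_indic // setIT; exact: probE.
  - move=> k; apply/measurable_EFinP; exact: measurable_indic.
have mS (K : Type) (u : seq K) (C : K -> set T) : (forall k, measurable (C k)) ->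
    measurable_fun setT (fun x => (\sum_(k <- u) \1_(C k) x : R)%:E).
  move=> mC; apply/measurable_EFinP; apply: measurable_sum => k.
  exact: measurable_indic.
have S0 (K : Type) (u : seq K) (C : K -> set T) x :
    (0 <= (\sum_(k <- u) \1_(C k) x : R)%:E)%E.
  by rewrite lee_fin sumr_ge0.
rewrite -lee_fin EFinM -!intE // -(ge0_integralZl mu measurableT (mS _ t B mB)) //.
apply: ge0_le_integral => //; first exact: mS.
  by apply: measurable_funeM; exact: mS.
by move=> x _; rewrite -EFinM lee_fin.
Qed.

Lemma prob_bigcup_le (I : choiceType) (s : seq I) (A : I -> set T) :
  (forall i, measurable (A i)) ->
  measurable [set x | exists2 i, i \in s & A i x] /\
  prob [set x | exists2 i, i \in s & A i x] <= \sum_(i <- s) prob (A i).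
Proof.
move=> mA.
have UE : [set x | exists2 i, i \in s & A i x] = \big[setU/set0]_(i <- s) A i.
  apply/seteqP; split=> x /=.
    by move=> [i si Aix]; rewrite -bigcup_seq; exists i.
  by rewrite -bigcup_seq => -[i /= si Aix]; exists i.
have mU : measurable [set x | exists2 i, i \in s & A i x].
  by rewrite UE; exact: bigsetU_measurable.
split=> //.
have := @prob_sum_le unit I [:: tt] s (fun=> [set x | exists2 i, i \in s & A i x]) A 1.
rewrite big_seq1 mul1r; apply=> // x; rewrite big_seq1 mul1r.
rewrite indicE; case: (boolP (x \in _)) => [|_]; last by rewrite sumr_ge0.
rewrite inE /= => -[i si Aix]; rewrite (big_rem i) //= indicE mem_set // lerDl.
by rewrite sumr_ge0.
Qed.

End RealProbability.

(** * Approximation of Borel sets by continuous functions *)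

Section BorelApproximation.
Variables (G : groupType) (S : seq G).
Hypotheses (symS : symmetric_gen S) (genS : generates S).
Variable D : nat.
Hypothesis hypD : four_point S D.
Variable R : realType.
Local Notation X := (compactification S).
Local Notation B := (borel_space S R).

Lemma open_set_measurable (U : set B) : open_set R U -> measurable U.
Proof. exact: sub_sigma_algebra. Qed.

Lemma borel_induction (P : set (set B)) :
  (forall U, open_set R U -> P U) -> (forall A, P A -> P (~` A)) ->
  (forall F : (set B)^nat, (forall n, P (F n)) -> P (\bigcup_n F n)) ->
  forall A, measurable A -> P A.
Proof.
move=> Popen PC PU A; apply: smallest_sub => //; split.
- by apply: Popen => x.
- by move=> C PCc; rewrite setTD; exact: PC.
- exact: PU.
Qed.

Lemma cont_measurable (f : B -> R) : cont_fun f -> measurable_fun setT f.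
Proof.
move=> /(cont_funP symS genS f) cf.
apply: (measurability (@RGenOInfty.G R)); first exact: RGenOInfty.measurableE.
move=> _ [_ [r ->] <-]; rewrite setTI; apply: open_set_measurable.
apply/(open_setP symS genS) => x; rewrite /= in_itv /= andbT => rx.
have [|n hn] := cf x (f x - r); first by rewrite subr_gt0.
exists n => y /hn; rewrite /= in_itv /= andbT ltr_distl => /andP[].
by rewrite subKr.
Qed.

Lemma cact_measurable g : measurable_fun setT (cact g : B -> B).
Proof.
apply: (@measurability _ _ B B setT (cact g) (@open_set G S R)) => // _ [U oU <-].
rewrite setTI.
apply: open_set_measurable; apply/(open_setP symS genS) => x /= Ux.
have [n hn] := (open_setP symS genS R U).1 oU _ Ux.
exists (n + 2 * wordlen S g)%N => y nxy; apply: hn; exact: bnear_cact nxy.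
Qed.

Lemma cact_preimage_measurable g (A : set B) :
  measurable A -> measurable (cact g @^-1` A : set B).
Proof. by move=> mA; rewrite -[_ @^-1` _]setTI; exact: cact_measurable. Qed.

Lemma cont_preimage_measurable (f : B -> R) (Y : set R) :
  cont_fun f -> measurable Y -> measurable (f @^-1` Y : set B).
Proof. by move=> cf mY; rewrite -[_ @^-1` _]setTI; exact: cont_measurable. Qed.

(* The set where [f] differs from the indicator function of [A]. *)
Definition discrepancy (f : B -> R) (A : set B) : set B :=
  (A `\` f @^-1` [set 1]) `|` (~` (f @^-1` [set 0]) `\` A).

Lemma discrepancy_measurable f A :
  cont_fun f -> measurable A -> measurable (discrepancy f A).
Proof.
move=> cf mA; apply: measurableU; apply: measurableD => //.
  exact: cont_preimage_measurable.
by apply: measurableC; exact: cont_preimage_measurable.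
Qed.

Lemma cont_funC (f : B -> R) : cont_fun f -> cont_fun (fun x => 1 - f x).
Proof.
move=> /(cont_funP symS genS f) cf; apply/(cont_funP symS genS) => x e e0.
have [n hn] := cf x e e0; exists n => y /hn.
have -> : 1 - f y - (1 - f x) = - (f y - f x) by ring.
by rewrite normrN.
Qed.

Lemma cont_fun_max (f g : B -> R) :
  cont_fun f -> cont_fun g -> cont_fun (fun x => Num.max (f x) (g x)).
Proof.
move=> /(cont_funP symS genS f) cf /(cont_funP symS genS g) cg.
apply/(cont_funP symS genS) => x e e0.
have [n hn] := cf x e e0; have [m hm] := cg x e e0.
exists (maxn n m) => y nxy.
have := hn y (bnearW (leq_maxl n m) nxy); have := hm y (bnearW (leq_maxr n m) nxy).
rewrite !ltr_norml => /andP[a1 a2] /andP[a3 a4].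
case: (leP (f y) (g y)); case: (leP (f x) (g x)) => ? ?; apply/andP; split; lra.
Qed.

(** Only these three properties are kept of the set function, so that it may be [mu] plus a
    translate of [mu] and one function approximates for both. *)
Variable w : set B -> R.
Hypotheses (w_le : forall A C : set B, measurable A -> measurable C -> A `<=` C -> w A <= w C)
  (w_U : forall A C : set B, measurable A -> measurable C -> w (A `|` C) <= w A + w C)
  (w_vanish : forall F : (set B)^nat, (forall n, measurable (F n)) ->
     (forall n, F n.+1 `<=` F n) -> (forall x, exists n, ~ F n x) ->
     forall e, 0 < e -> exists n, w (F n) < e).

Let approximable (A : set B) := measurable A /\ forall e, 0 < e ->
  exists f : B -> R, [/\ cont_fun f, forall x, 0 <= f x <= 1 & w (discrepancy f A) < e].

Let approx_open U : open_set R U -> approximable U.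
Proof.
move=> oU; split; first exact: open_set_measurable.
pose A n := [set x : X | forall y, bnear n x y -> U y].
have /choice[f hf] n : exists f : X -> R, [/\ cont_fun f, forall x, 0 <= f x <= 1,
    forall x, (~` U) x -> f x = 0 & forall x, A n x -> f x = 1].
  apply: (@boundary_urysohn _ _ symS genS D hypD R _ _ n) => x y Ux Ay /(bnearC symS genS) nyx.
  by apply: Ux; apply: Ay; apply: nyx.
have mdf n : measurable (discrepancy (f n) U).
  by have [cf _ _ _] := hf n; apply: discrepancy_measurable => //; exact: open_set_measurable.
(* Tails of the discrepancies decrease. A point outside [U] is in none of them, and a point of [U]
   leaves them once its [n]-neighbourhood fits into [U]. *)
pose F n := \bigcup_(k in [set k | (n <= k)%N]) discrepancy (f k) U.
have mF n : measurable (F n) by apply: bigcup_measurable => k _.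
move=> e e0; have [|x|n hn] := w_vanish mF _ _ e0.
- by move=> n x [k /= /ltnW nk fk]; exists k.
- have [Ux|nUx] := pselect (U x); last first.
    by exists 0%N => -[k _ [[/nUx//]|[nf _]]]; have [_ _ f0 _] := hf k; apply/nf/f0.
  have [n hn] := (open_setP symS genS R U).1 oU _ Ux; exists n => -[k /= nk].
  have fk1 : f k x = 1.
    by have [_ _ _ ->] := hf k => // y nxy; apply: hn; exact: bnearW nk nxy.
  by move=> [] [].
- have [cf f01 _ _] := hf n; exists (f n); split=> //.
  by apply: le_lt_trans hn; apply: w_le => // x dx; exists n => /=.
Qed.

Let approxC A : approximable A -> approximable (~` A).
Proof.
move=> [mA H]; split; first exact: measurableC.
move=> e /H[f [cf f01 fe]]; exists (fun x => 1 - f x).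
have cf' := cont_funC cf; split=> //.
  by move=> x; have := f01 x; move=> /andP[? ?]; apply/andP; split; lra.
apply: le_lt_trans fe; apply: w_le.
- by apply: discrepancy_measurable => //; exact: measurableC.
- exact: discrepancy_measurable.
move=> x [[/= nA nf]|[/= nf /contrapT Ax]].
  by right; split=> //= f0; apply: nf; rewrite f0 subr0.
by left; split=> //= f1; apply: nf; rewrite f1 subrr.
Qed.

Let approxU A C : approximable A -> approximable C -> approximable (A `|` C).
Proof.
move=> [mA HA] [mC HC]; split; first exact: measurableU.
move=> e e0; have e2 : 0 < e / 2 by rewrite divr_gt0.
have [f [cf f01 fe]] := HA _ e2; have [g [cg g01 ge]] := HC _ e2.
have cm := cont_fun_max cf cg; exists (fun x => Num.max (f x) (g x)); split=> //.
  move=> x; have /andP[? ?] := f01 x; have /andP[? ?] := g01 x.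
  by case: (leP (f x) (g x)) => _; apply/andP.
have mf := discrepancy_measurable cf mA; have mg := discrepancy_measurable cg mC.
rewrite [e]splitr; apply: le_lt_trans (ltrD fe ge).
apply: le_trans (w_U mf mg); apply: w_le.
- by apply: discrepancy_measurable => //; exact: measurableU.
- exact: measurableU.
move=> x; have /andP[f0 f1] := f01 x; have /andP[g0 g1] := g01 x.
move=> [[/= AC nm]|[/= nm nAC]].
  case: AC => [Ax|Cx]; [left|right]; left; split=> //= E; apply: nm; rewrite E.
    by apply/max_idPl.
  by apply/max_idPr.
have [f0'|nf0] := pselect (f x = 0); last first.
  by left; right; split=> //= Ax; apply: nAC; left.
right; right; split=> /=; last by move=> Cx; apply: nAC; right.
by move=> g0'; apply: nm; rewrite f0' g0' maxxx.
Qed.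

Lemma cont_approx (A : set B) : measurable A -> forall e, 0 < e ->
  exists f : B -> R, [/\ cont_fun f, forall x, 0 <= f x <= 1 & w (discrepancy f A) < e].
Proof.
move=> mA; suff [] : approximable A by [].
apply: (borel_induction (P := approximable)) mA => // F HF.
have mU : measurable (\bigcup_n F n) by apply: bigcup_measurable => n _; have [] := HF n.
have HN n : approximable (\big[setU/set0]_(k < n) F k).
  elim: n => [|n IH]; first by rewrite big_ord0; apply: approx_open => x.
  by rewrite big_ord_recr; exact: approxU.
split=> // e e0; have e2 : 0 < e / 2 by rewrite divr_gt0.
(* The part of the union missed by the first [n] sets; it decreases to nothing, so a finite union,
   already approximable, suffices. *)
pose V n := \bigcup_n F n `\` \big[setU/set0]_(k < n) F k.
have mV n : measurable (V n) by apply: measurableD => //; have [] := HN n.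
have [|x|n hn] := w_vanish mV _ _ e2.
- move=> n; apply: setDS; rewrite big_ord_recr; exact: subsetUl.
- have [[n _ Fnx]|nx] := pselect ((\bigcup_n F n) x); last by exists 0%N => -[].
  by exists n.+1 => -[_]; apply; rewrite big_ord_recr; right.
have [mN /(_ _ e2)[f [cf f01 fe]]] := HN n.
exists f; split=> //; rewrite [e]splitr; apply: le_lt_trans (ltrD fe hn).
have md := discrepancy_measurable cf mN; apply: le_trans (w_U md (mV n)).
apply: w_le; [exact: discrepancy_measurable|exact: measurableU|].
move=> x [[/= Ux nf]|[/= nf nUx]].
  have [Nx|nNx] := pselect ((\big[setU/set0]_(k < n) F k) x); last by right.
  by left; left.
left; right; split=> //= Nx; apply: nUx; move: Nx; rewrite -bigcup_mkord.
by move=> [k _ Fkx]; exists k.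
Qed.

End BorelApproximation.

Lemma ler_sum_subset (R : realType) (I : eqType) (s t : seq I) (F : I -> R) :
  uniq s -> uniq t -> {subset s <= t} -> (forall i, 0 <= F i) ->
  \sum_(i <- s) F i <= \sum_(i <- t) F i.
Proof.
move=> us ut st F0; rewrite [leRHS](bigID (mem s)) /= -[\sum_(i <- t | _) _]big_filter.
rewrite (perm_big [seq i <- t | i \in s]); first by rewrite lerDl sumr_ge0.
apply: uniq_perm => //; first exact: filter_uniq.
by move=> i; rewrite mem_filter; case: (boolP (i \in s)) => // /st ->.
Qed.

(** * Scaling of the measure under translations *)

Section PattersonSullivan.
Variables (G : groupType) (S : seq G).
Hypotheses (symS : symmetric_gen S) (genS : generates S).
Variable D : nat.
Hypothesis hypD : four_point S D.
Variables (R : realType) (lam C : R).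
Hypotheses (lam1 : 1 < lam) (s_ge : forall n, lam ^+ n <= (size (sphere S n))%:R)
  (s_le : forall n, (size (sphere S n))%:R <= C * lam ^+ n).
Local Notation X := (compactification S).
Local Notation B := (borel_space S R).
Local Notation len := (wordlen S).
Local Notation ball := (Defs.ball S).
Variable mu : probability B R.
Hypothesis psmu : patterson_sullivan lam mu.
Local Notation m := (prob mu).

Let E (f : B -> R) : R := fine (\int[mu]_x (f x)%:E)%E.

Let lam0 : 0 < lam. Proof. exact: lt_trans lam1. Qed.

Let expectation_fin_num (f : B -> R) : cont_fun f -> (forall x, 0 <= f x <= 1) ->
  (\int[mu]_x (f x)%:E)%E \is a fin_num.
Proof.
move=> cf f01; rewrite ge0_fin_numE; last first.
  by apply: integral_ge0 => x _; rewrite lee_fin; have /andP[] := f01 x.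
apply: (@le_lt_trans _ _ (\int[mu]_x (cst 1%:E x))%E).
  apply: ge0_le_integral => //.
  - by move=> x _; rewrite lee_fin; have /andP[] := f01 x.
  - by apply/measurable_EFinP; exact: cont_measurable.
  - by move=> x _; rewrite lee_fin; have /andP[] := f01 x.
by rewrite integral_cst // mul1e; apply: le_lt_trans (probability_le1 mu measurableT) (ltry 1).
Qed.

Lemma prob_le_expectation (f : B -> R) (A : set B) :
  cont_fun f -> (forall x, 0 <= f x <= 1) -> measurable A ->
  (forall x, A x -> f x = 1) -> m A <= E f.
Proof.
move=> cf f01 mA f1; apply: fine_le; first exact: fin_num_measure.
  exact: expectation_fin_num.
have <- : (\int[mu]_x (\1_A x)%:E = mu A)%E by rewrite integral_indic // setIT.
apply: ge0_le_integral => //.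
- by apply/measurable_EFinP; exact: measurable_indic.
- by apply/measurable_EFinP; exact: cont_measurable.
move=> x _; rewrite lee_fin indicE; case: (boolP (x \in A)) => [|_].
  by rewrite inE => /f1 ->.
by have /andP[] := f01 x.
Qed.

Lemma expectation_le_prob (f : B -> R) (A : set B) :
  cont_fun f -> (forall x, 0 <= f x <= 1) -> measurable A ->
  (forall x, ~ A x -> f x = 0) -> E f <= m A.
Proof.
move=> cf f01 mA f0; apply: fine_le; last 1 first.
- have <- : (\int[mu]_x (\1_A x)%:E = mu A)%E by rewrite integral_indic // setIT.
  apply: ge0_le_integral => //.
  + by move=> x _; rewrite lee_fin; have /andP[] := f01 x.
  + by apply/measurable_EFinP; exact: cont_measurable.
  + by apply/measurable_EFinP; exact: measurable_indic.
  move=> x _; rewrite lee_fin indicE; case: (boolP (x \in A)) => [_|/negP].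
    by have /andP[] := f01 x.
  by rewrite inE => /f0 ->.
- exact: expectation_fin_num.
- exact: fin_num_measure.
Qed.

Let mass n (F : G -> R) : R := \sum_(h <- ball n) lam ^- len h * F h.

Lemma mass_translate (F1 F2 : G -> R) (g : G) (c : R) n :
  (forall h, 0 <= F2 h) -> 0 <= c ->
  (forall h : G, lam ^- len h * F1 h <= c * (lam ^- len (g * h)%g * F2 (g * h)%g)) ->
  mass n F1 <= c * mass (n + len g) F2.
Proof.
move=> F20 c0 le12; apply: le_trans (ler_sum _ (fun h _ => le12 h)) _.
rewrite -mulr_sumr ler_wpM2l //.
rewrite -(big_map (fun h => g * h)%g xpredT (fun h => lam ^- len h * F2 h)).
apply: ler_sum_subset.
- by rewrite map_inj_uniq ?wball_uniq //; exact: mulgI.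
- exact: wball_uniq.
- move=> _ /mapP[/= h + ->]; rewrite !mem_wball // => lh.
  by have := wordlenM genS g h; glia.
- by move=> h; rewrite mulr_ge0 // invr_ge0 exprn_ge0 // ltW.
Qed.

Lemma ball_recr n : perm_eq (ball n.+1) (ball n ++ sphere S n.+1).
Proof.
apply: uniq_perm; first exact: wball_uniq.
  rewrite cat_uniq wball_uniq sphere_uniq andbT; apply/hasPn => g.
  by rewrite mem_sphere // mem_wball // => /eqP->; rewrite ltnn.
by move=> g; rewrite mem_cat !mem_wball // mem_sphere // leq_eqVlt orbC ltnS.
Qed.

Lemma massS n F : mass n.+1 F = mass n F + lam ^- n.+1 * \sum_(h <- sphere S n.+1) F h.
Proof.
rewrite /mass (perm_big _ (ball_recr n)) big_cat /= mulr_sumr; congr (_ + _).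
rewrite [LHS]big_seq [RHS]big_seq; apply: eq_bigr => h.
by rewrite mem_sphere // => /eqP->.
Qed.

(** Each sphere contributes at most [C], by the upper bound on its size; a translation therefore
    changes a sum over a ball by a bounded boundary term. *)
Lemma mass_shell n k F : (forall h, 0 <= F h <= 1) -> mass (n + k) F <= mass n F + C * k%:R.
Proof.
move=> F01; elim: k => [|k IH]; first by rewrite addn0 mulr0 addr0.
rewrite addnS massS -[k.+1]addn1 natrD mulr1n mulrDr mulr1 addrA lerD //.
rewrite mulrC ler_pdivrMr ?exprn_gt0 //; apply: le_trans (s_le _).
apply: le_trans (_ : \sum_(h <- sphere S (n + k).+1) 1 <= _).
  by apply: ler_sum => h _; have /andP[] := F01 h.
by rewrite big_const_seq count_predT iter_addr_0.
Qed.

Lemma mass1_ge n : n.+1%:R <= mass n (fun=> 1).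
Proof.
elim: n => [|n IH].
  apply: (@le_trans _ _ (\sum_(h <- [:: 1%g : G]) lam ^- len h * 1)).
    by rewrite big_seq1 wordlen1 // expr0 invr1 mulr1.
  apply: ler_sum_subset => //.
  by move=> h; rewrite mulr1 invr_ge0 exprn_ge0 // ltW.
rewrite massS -[n.+2]addn1 natrD lerD // big_const_seq count_predT iter_addr_0.
by rewrite mulrC ler_pdivlMr ?exprn_gt0 // mul1r.
Qed.

(** The total mass of the ball of radius [n] is at least [n + 1], so the additive constant
    disappears in the normalised limit. *)
Lemma expectation_le (f F : B -> R) (c K : R) :
  cont_fun f -> (forall x, 0 <= f x <= 1) -> cont_fun F -> (forall x, 0 <= F x <= 1) ->
  0 <= c ->
  (forall n, mass n (fun h => f (Pt S h)) <= c * (mass n (fun h => F (Pt S h)) + K)) ->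
  E f <= c * E F.
Proof.
move=> cf f01 cF F01 c0 H; have [nk [nk_lt nk_cvg]] := psmu.
have bnd (g : B -> R) : (forall x, 0 <= g x <= 1) -> Defs.bounded_fun g.
  by move=> g01; exists 1 => x; have /andP[g0 g1] := g01 x; rewrite ger0_norm.
have lf := nk_cvg f cf (bnd _ f01); have lF := nk_cvg F cF (bnd _ F01).
have nk_ge k : (k <= nk k)%N by elim: k => // k IH; apply: leq_ltn_trans (nk_lt k).
have lh : (fun k : nat => c * (ps_avg lam (nk k) F + `|K| * harmonic k)) @ \oo -->
    c * (E F + `|K| * 0).
  by apply: cvgMr; apply: cvgD => //; apply: cvgMr; exact: cvg_harmonic.
rewrite mulr0 addr0 in lh; apply: ler_cvg_to lf lh _.
near=> k; have k0 : (0 < k)%N by near: k; exact: nbhs_infty_gt.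
have n0 : (0 : R) < (nk k).+1%:R by rewrite ltr0n.
have Zgt0 : 0 < mass (nk k) (fun=> 1) by apply: lt_le_trans (mass1_ge _).
have ZE : \sum_(g <- ball (nk k)) lam ^- len g = mass (nk k) (fun=> 1).
  by apply: eq_bigr => h _; rewrite mulr1.
rewrite /ps_avg ZE ler_pdivrMr //; apply: le_trans (H _) _.
rewrite -mulrA ler_wpM2l // mulrDl divfK ?gt_eqF // lerD2l -mulrA.
apply: (@le_trans _ _ `|K|); first exact: ler_norm.
rewrite ler_peMr // mulrC ler_pdivlMr // mul1r.
by apply: le_trans (mass1_ge _); rewrite ler_nat ltnS nk_ge.
Unshelve. all: by end_near. Qed.

Lemma expV_le a b c : (c <= a + b)%N -> lam ^- a <= lam ^+ b * lam ^- c.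
Proof.
move=> le_c; rewrite ler_pdivlMr ?exprn_gt0 // mulrC ler_pdivrMr ?exprn_gt0 //.
by rewrite -exprD ler_weXn2l ?ltW // addnC.
Qed.

Lemma cont_fun_cact (f : B -> R) g : cont_fun f -> cont_fun (f \o cact g).
Proof.
move=> /(cont_funP symS genS f) cf; apply/(cont_funP symS genS) => x e /(cf (cact g x))[n hn].
exists (n + 2 * len g)%N => y nxy; apply: hn; exact: bnear_cact nxy.
Qed.

Lemma cont_funM (f g : B -> R) : cont_fun f -> cont_fun g ->
  (forall x, 0 <= f x <= 1) -> (forall x, 0 <= g x <= 1) ->
  cont_fun (fun x => f x * g x).
Proof.
move=> /(cont_funP symS genS f) cf /(cont_funP symS genS g) cg f01 g01.
apply/(cont_funP symS genS) => x e e0.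
have e2 : 0 < e / 2 by rewrite divr_gt0.
have [n hn] := cf x _ e2; have [k hk] := cg x _ e2.
exists (maxn n k) => y nxy.
have := hn y (bnearW (leq_maxl n k) nxy); have := hk y (bnearW (leq_maxr n k) nxy).
have -> : f y * g y - f x * g x = f y * (g y - g x) + (f y - f x) * g x by ring.
move=> hg hf; apply: le_lt_trans (ler_normD _ _) _; rewrite [e]splitr !normrM.
have /andP[f0 f1] := f01 y; have /andP[g0 g1] := g01 x.
rewrite (ger0_norm f0) (ger0_norm g0); apply: ltrD.
  by apply: le_lt_trans hg; rewrite ler_piMl.
by apply: le_lt_trans hf; rewrite ler_piMr.
Qed.

Let C0 : 0 <= C.
Proof. by have := le_trans (s_ge 0) (s_le 0); rewrite expr0 mulr1; exact: le_trans. Qed.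

(** Termwise this is [|g h| <= |g| + |h|]. *)
Lemma translate_le (f : B -> R) (g : G) : cont_fun f -> (forall x, 0 <= f x <= 1) ->
  E (f \o cact g) <= lam ^+ len g * E f.
Proof.
move=> cf f01; apply: (@expectation_le _ _ _ (C * (len g)%:R)) => //.
- exact: cont_fun_cact.
- by move=> x; exact: f01.
- by rewrite exprn_ge0 // ltW.
move=> n; apply: (@le_trans _ _ (lam ^+ len g * mass (n + len g) (fun h => f (Pt S h)))).
  apply: mass_translate => [h||h]; first by have /andP[] := f01 (Pt S h).
    by rewrite exprn_ge0 // ltW.
  rewrite /= mulrA ler_wpM2r //; first by have /andP[] := f01 (Pt S (g * h)%g).
  by apply: expV_le; have := wordlenM genS g h; glia.
have c0 : 0 <= lam ^+ len g by rewrite exprn_ge0 // ltW.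
by rewrite ler_wpM2l //; apply: mass_shell => h; exact: f01.
Qed.

(** On the support of [chi] one has [|g^-1 h| <= |h| - |g| + Rd], which reverses the comparison of
    the weights. *)
Lemma translate_window_le (f chi : B -> R) (g : G) Rd :
  cont_fun f -> (forall x, 0 <= f x <= 1) -> cont_fun chi -> (forall x, 0 <= chi x <= 1) ->
  (forall x, ~ shadow Rd g x -> chi x = 0) ->
  E (fun x => f x * chi x) <= lam ^+ Rd / lam ^+ len g * E (f \o cact g).
Proof.
move=> cf f01 cchi chi01 chi0.
have c0 : 0 <= lam ^+ Rd / lam ^+ len g by rewrite divr_ge0 // exprn_ge0 // ltW.
apply: (@expectation_le _ _ _ (C * (len g)%:R)) => //.
- exact: cont_funM.
- move=> x; have /andP[f0 f1] := f01 x; have /andP[g0 g1] := chi01 x.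
  by rewrite mulr_ge0 // mulr_ile1.
- exact: cont_fun_cact.
- by move=> x; exact: f01.
move=> n; apply: (@le_trans _ _ (lam ^+ Rd / lam ^+ len g *
    mass (n + len g^-1%g) (fun h => f (Pt S (g * h)%g)))).
  apply: mass_translate => // h; first by have /andP[] := f01 (Pt S (g * h)%g).
  rewrite mulVKg; have /andP[f0 f1] := f01 (Pt S h).
  have [sh|/chi0 ->] := pselect (shadow Rd g (Pt S h)); last first.
    by rewrite !mulr0 mulr_ge0 // mulr_ge0 // invr_ge0 exprn_ge0 // ltW.
  apply: (@le_trans _ _ (lam ^- len h * f (Pt S h))).
    rewrite ler_wpM2l //; first by rewrite invr_ge0 exprn_ge0 // ltW.
    by have /andP[? ?] := chi01 (Pt S h); rewrite ler_piMr.
  rewrite mulrA ler_wpM2r // -mulrA -invfM -exprD.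
  by apply: expV_le; have := shadow_pt sh; rewrite /wdist; glia.
rewrite ler_wpM2l // (wordlenV symS genS); apply: mass_shell => h.
exact: f01.
Qed.

Section Approximation.
Variable g : G.

(** Both scaling inequalities compare a set with its preimage under [g], so [f] must be accurate on
    both. *)
Let w (A : set B) := m A + m (cact g @^-1` A).

Let w_le (A A' : set B) : measurable A -> measurable A' -> A `<=` A' -> w A <= w A'.
Proof.
move=> mA mA' AA'; apply: lerD; apply: prob_le => //; try exact: cact_preimage_measurable.
exact: preimage_subset.
Qed.

Let w_U (A A' : set B) : measurable A -> measurable A' -> w (A `|` A') <= w A + w A'.
Proof.
move=> mA mA'; rewrite /w addrACA preimage_setU.
by apply: lerD; apply: probU => //; exact: cact_preimage_measurable.
Qed.

Let w_vanish (F : (set B)^nat) : (forall n, measurable (F n)) ->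
  (forall n, F n.+1 `<=` F n) -> (forall x, exists n, ~ F n x) ->
  forall e, 0 < e -> exists n, w (F n) < e.
Proof.
move=> mF dF F0 e e0; have e2 : 0 < e / 2 by rewrite divr_gt0.
have dF' n k : (n <= k)%N -> F k `<=` F n.
  by move=> /subnK <-; elim: (k - n)%N => // j IH; apply: subset_trans IH; exact: dF.
have [n hn] := prob_vanish mu mF dF F0 e2.
have [|||k hk] := @prob_vanish _ _ _ mu (fun n => cact g @^-1` F n) _ _ _ _ e2.
- by move=> k; exact: cact_preimage_measurable.
- by move=> k; apply: preimage_subset; exact: dF.
- by move=> x; exact: F0.
exists (maxn n k); rewrite [e]splitr; apply: ltrD.
  by apply: le_lt_trans hn; apply: prob_le => //; apply: dF'; rewrite leq_maxl.
apply: le_lt_trans hk; apply: prob_le; try exact: cact_preimage_measurable.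
by apply: preimage_subset; apply: dF'; rewrite leq_maxr.
Qed.

Let approx (A : set B) e : measurable A -> 0 < e ->
  exists f : B -> R, [/\ cont_fun f, forall x, 0 <= f x <= 1,
    measurable (discrepancy f A), m (discrepancy f A) < e &
    m (cact g @^-1` discrepancy f A) < e].
Proof.
move=> mA e0; have [f [cf f01 fe]] := cont_approx symS genS hypD w_le w_U w_vanish mA e0.
exists f; split=> //; first exact: discrepancy_measurable.
- by apply: le_lt_trans fe; rewrite lerDl prob_ge0.
- by apply: le_lt_trans fe; rewrite lerDr prob_ge0.
Qed.

Lemma quasi_lower (A : set B) : measurable A ->
  m (cact g @^-1` A) <= lam ^+ len g * m A.
Proof.
move=> mA; apply/ler_addgt0Pr => e e0; have c0 : 0 <= lam ^+ len g by rewrite exprn_ge0 // ltW.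
(* The approximation error enters once directly and once multiplied by [lam ^+ len g]. *)
have e1 : 0 < e / (lam ^+ len g + 1) by rewrite divr_gt0 // ltr_wpDl.
have [f [cf f01 md /ltW le1 /ltW le2]] := approx mA e1.
have mf1 := cont_preimage_measurable symS genS cf (measurable_set1 (1 : R)).
have mf0 := measurableC (cont_preimage_measurable symS genS cf (measurable_set1 (0 : R))).
have h1 : m (cact g @^-1` A) <= m (cact g @^-1` (f @^-1` [set 1])) + e / (lam ^+ len g + 1).
  apply: le_trans (lerD (lexx _) le2).
  apply: le_trans (probU mu (cact_preimage_measurable symS genS g mf1)
    (cact_preimage_measurable symS genS g md)).
  rewrite -preimage_setU; apply: prob_le; first exact: cact_preimage_measurable.
    by apply: cact_preimage_measurable => //; exact: measurableU.
  move=> x /= Ax.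
  by have [?|nf] := pselect (f (cact g x) = 1); [left|right; left].
have h2 : m (cact g @^-1` (f @^-1` [set 1])) <= E (f \o cact g).
  apply: prob_le_expectation => //; first exact: cont_fun_cact.
    by move=> x; exact: f01.
  exact: cact_preimage_measurable.
have h3 := translate_le g cf f01.
have h4 : E f <= m (~` (f @^-1` [set 0])).
  by apply: expectation_le_prob => // x /contrapT.
have h5 : m (~` (f @^-1` [set 0])) <= m A + e / (lam ^+ len g + 1).
  apply: le_trans (lerD (lexx _) le1); apply: le_trans (probU mu mA md).
  apply: prob_le => //; first exact: measurableU.
  by move=> x nf; have [Ax|nA] := pselect (A x); [left|right; right].
have h6 : lam ^+ len g * E f <= lam ^+ len g * (m A + e / (lam ^+ len g + 1)).
  by rewrite ler_wpM2l // (le_trans h4).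
have -> : e = (lam ^+ len g + 1) * (e / (lam ^+ len g + 1)).
  by rewrite mulrC divfK // gt_eqF // ltr_wpDl.
apply: le_trans h1 _; apply: le_trans (lerD (le_trans h2 (le_trans h3 h6)) (lexx _)) _.
by rewrite mulrDr mulrDl mul1r addrA.
Qed.

(** The window is a level set of a Urysohn function, which gives a Borel set between two shadows and
    at the same time the cutoff needed for the reverse scaling. *)
Lemma shadow_window (Rd : nat) : exists W : set B,
  [/\ measurable W, forall x, shadow Rd g x -> W x,
      forall x, W x -> shadow (Rd + 2 * D) g x &
      forall A : set B, measurable A ->
        m (A `&` W) <= lam ^+ (Rd + 2 * D) / lam ^+ len g * m (cact g @^-1` A)].
Proof.
have [chi [cchi chi01 chi0 chi1]] : exists chi : B -> R, [/\ cont_fun chi,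
    forall x, 0 <= chi x <= 1, forall x, (~` shadow (Rd + 2 * D) g) x -> chi x = 0 &
    forall x, shadow Rd g x -> chi x = 1].
  apply: (@boundary_urysohn _ _ symS genS D hypD R _ _ (2 * len g)) => x y nsx sy.
  move=> /(bnearC symS genS) nyx; apply: nsx.
  exact: (shadow_near symS genS hypD sy nyx).
pose W : set B := chi @^-1` [set 1].
have mW : measurable W by exact: cont_preimage_measurable.
exists W; split=> // [x Wx|A mA].
  apply: contrapT => /chi0 chix; move: Wx; rewrite /W /= chix => /eqP.
  by rewrite eq_sym oner_eq0.
set c := lam ^+ (Rd + 2 * D) / lam ^+ len g.
have c0 : 0 <= c by rewrite divr_ge0 // exprn_ge0 // ltW.
apply/ler_addgt0Pr => e e0; have e1 : 0 < e / (c + 1) by rewrite divr_gt0 // ltr_wpDl.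
have [f [cf f01 md /ltW le1 /ltW le2]] := approx mA e1.
have mf1 := cont_preimage_measurable symS genS cf (measurable_set1 (1 : R)).
have mf0 := measurableC (cont_preimage_measurable symS genS cf (measurable_set1 (0 : R))).
have h1 : m (A `&` W) <= m (f @^-1` [set 1] `&` W) + e / (c + 1).
  apply: le_trans (lerD (lexx _) le1); have mI := measurableI _ _ mf1 mW.
  apply: le_trans (probU mu mI md); apply: prob_le; [exact: measurableI|exact: measurableU|].
  move=> x [Ax Wx]; have [?|nf] := pselect (f x = 1); first by left.
  by right; left.
have h2 : m (f @^-1` [set 1] `&` W) <= E (fun x => f x * chi x).
  apply: prob_le_expectation.
  - exact: cont_funM.
  - move=> x; have /andP[f0 f1] := f01 x; have /andP[g0 g1] := chi01 x.
    by rewrite mulr_ge0 // mulr_ile1.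
  - exact: measurableI.
  - by move=> x [/= -> Wx]; rewrite mul1r.
have h3 := translate_window_le cf f01 cchi chi01 chi0.
have h4 : E (f \o cact g) <= m (cact g @^-1` (~` (f @^-1` [set 0]))).
  apply: expectation_le_prob => //; first exact: cont_fun_cact.
  - by move=> x; exact: f01.
  - exact: cact_preimage_measurable.
  - by move=> x /contrapT.
have h5 : m (cact g @^-1` (~` (f @^-1` [set 0]))) <= m (cact g @^-1` A) + e / (c + 1).
  apply: le_trans (lerD (lexx _) le2).
  apply: le_trans (probU mu (cact_preimage_measurable symS genS g mA)
    (cact_preimage_measurable symS genS g md)).
  rewrite -preimage_setU; apply: prob_le; first exact: cact_preimage_measurable.
    by apply: cact_preimage_measurable => //; exact: measurableU.
  move=> x /= nf.
  by have [Ax|nA] := pselect (A (cact g x)); [left|right; right].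
have h6 : c * E (f \o cact g) <= c * (m (cact g @^-1` A) + e / (c + 1)).
  by rewrite ler_wpM2l // (le_trans h4).
have -> : e = (c + 1) * (e / (c + 1)) by rewrite mulrC divfK // gt_eqF // ltr_wpDl.
apply: le_trans h1 _; apply: le_trans (lerD (le_trans h2 (le_trans h3 h6)) (lexx _)) _.
by rewrite mulrDr mulrDl mul1r addrA.
Qed.

End Approximation.
End PattersonSullivan.

(** * Ergodicity and the subadditive theorem *)

Section Sequences.
Variable R : realType.

Lemma ler_sum_range (b : nat -> R) n1 m1 n2 m2 : (forall i, 0 <= b i) ->
  (n2 <= n1)%N -> (m1 <= m2)%N ->
  \sum_(n1 <= i < m1) b i <= \sum_(n2 <= i < m2) b i.
Proof.
move=> b0 le_n le_m; apply: ler_sum_subset => //; try exact: iota_uniq.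
by move=> i; rewrite !mem_index_iota => /andP[h1 h2]; apply/andP; split; lia.
Qed.

(** Greedy choice from left to right: skip a [j] with [J j <= 0], otherwise jump over an interval on
    which [b] has average at least [eta]. The last interval may overrun [K] by at most [N]. *)
Lemma covering (J b : nat -> R) (eta : R) (N K : nat) : 0 <= eta ->
  (forall j, 0 <= b j) -> (forall j, J j <= 1) ->
  (forall j, J j <= 0 \/ exists n, [/\ (0 < n)%N, (n <= N)%N &
     eta * n%:R <= \sum_(j <= i < j + n) b i]) ->
  eta * \sum_(0 <= j < K) J j <= \sum_(0 <= i < K + N) b i.
Proof.
move=> eta0 b0 J1 H.
suff H' t : forall s, (K <= s + t)%N ->
    eta * \sum_(s <= j < K) J j <= \sum_(s <= i < K + N) b i by exact: (H' K).
elim/ltn_ind: t => t IH s Kst.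
have [le_Ks|lt_sK] := leqP K s.
  by rewrite big_geq // mulr0 sumr_ge0.
have [Js|[n [n0 nN hn]]] := H s.
  rewrite big_ltn // [leRHS](big_cat_nat (n := s.+1)) ?leqnSn //=; last by lia.
  apply: (@le_trans _ _ (eta * \sum_(s.+1 <= j < K) J j)).
    by rewrite ler_wpM2l // gerDr.
  apply: ler_wpDl; first exact: sumr_ge0.
  by apply: (IH t.-1); lia.
have [lt_K|le_K] := ltnP (s + n) K.
  rewrite (big_cat_nat (n := (s + n)%N)) /=; [|lia|lia].
  rewrite [leRHS](big_cat_nat (n := (s + n)%N)) /=; [|lia|lia].
  rewrite mulrDr; apply: lerD; last by apply: (IH (t - n)%N); lia.
  apply: le_trans hn; rewrite ler_wpM2l //.
  apply: le_trans (ler_sum _ (fun i _ => J1 i)) _.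
  by rewrite big_const_nat iter_addr_0 addKn.
apply: le_trans (le_trans hn _); last by apply: ler_sum_range => //; lia.
rewrite ler_wpM2l //; apply: le_trans (ler_sum _ (fun i _ => J1 i)) _.
by rewrite big_const_nat iter_addr_0 ler_nat; lia.
Qed.

(** Where possible, jump over a segment of slope at most [tau]; each remaining bad step, and each of
    the fewer than [N] steps of the truncated last segment, exceeds that slope by at most
    [c + |tau|]. *)
Lemma chunking (a b : nat -> R) (c tau : R) (N n : nat) : 0 <= c ->
  (forall k, 0 <= b k) -> (forall k, a k.+1 <= a k + c) ->
  (forall k, b k = 1 \/ exists l, [/\ (0 < l)%N, (l <= N)%N &
     a (k + l)%N <= a k + l%:R * tau]) ->
  a n <= a 0%N + n%:R * tau + (c + `|tau|) * (\sum_(0 <= k < n) b k + N%:R).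
Proof.
move=> c0 b0 step H.
have steps k l : a (k + l)%N <= a k + l%:R * c.
  elim: l => [|l IH]; first by rewrite addn0 mul0r addr0.
  by rewrite addnS; have := step (k + l)%N; rewrite -[l.+1]addn1 natrD; lra.
have tau0 := ler_norm (- tau); rewrite normrN in tau0.
have ct : 0 <= c + `|tau| by rewrite addr_ge0.
suff H' t : forall s, (s <= n)%N -> (n <= s + t)%N ->
    a n <= a s + (n - s)%:R * tau + (c + `|tau|) * (\sum_(s <= k < n) b k + N%:R).
  by have := H' n 0%N (leq0n n) (leqnn n); rewrite subn0.
elim/ltn_ind: t => t IH s sn nst.
have [->|neq] := eqVneq s n.
  rewrite subnn mul0r addr0 lerDl mulr_ge0 // addr_ge0 //.
  by rewrite sumr_ge0.
have lt_sn : (s < n)%N by rewrite ltn_neqAle neq.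
have [bs|[l [l0 lN hl]]] := H s.
  have := IH t.-1 _ s.+1 _ _; move=> /(_ _ _ _)/le_trans; apply; [lia|lia|lia|].
  rewrite [in leRHS]big_ltn // bs (_ : n - s = n - s.+1 + 1)%N; last by lia.
  by rewrite natrD; have := step s; move: (\sum_(_ <= _ < _) _) => x; lra.
have [le_n|lt_n] := leqP (s + l) n.
  have := IH (t - l)%N _ (s + l)%N _ _; move=> /(_ _ _ _)/le_trans; apply; [lia|lia|lia|].
  have -> : (n - s = (n - (s + l)) + l)%N by lia.
  have sb : \sum_(s + l <= k < n) b k <= \sum_(s <= k < n) b k.
    by apply: ler_sum_range => //; lia.
  rewrite natrD mulrDl; have := ler_wpM2l ct sb; rewrite !mulrDr; lra.
have := steps s (n - s)%N; rewrite subnKC // => /le_trans; apply.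
have S0 : 0 <= \sum_(s <= k < n) b k by rewrite sumr_ge0.
have dN : (n - s)%:R <= N%:R :> R by rewrite ler_nat; lia.
have := ler_wpM2l ct dN; have := mulr_ge0 ct S0; have : 0 <= (n - s)%:R :> R by [].
by move: (\sum_(_ <= _ < _) _) => x; nra.
Qed.

End Sequences.

(** * Windows, ergodicity and the maximal inequality *)

Section Ergodicity.
Variables (G : groupType) (S : seq G).
Hypotheses (symS : symmetric_gen S) (genS : generates S).
Variable D : nat.
Hypothesis hypD : four_point S D.
Variables (R : realType) (lam C : R).
Hypotheses (lam1 : 1 < lam) (s_ge : forall n, lam ^+ n <= (size (sphere S n))%:R)
  (s_le : forall n, (size (sphere S n))%:R <= C * lam ^+ n).
Local Notation X := (compactification S).
Local Notation B := (borel_space S R).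
Local Notation len := (wordlen S).
Local Notation dist := (wdist S).
Local Notation ball := (Defs.ball S).
Variable mu : probability B R.
Local Notation m := (prob mu).
Hypothesis quasi : forall g (A : set B), measurable A ->
  m (cact g @^-1` A) <= lam ^+ len g * m A.
Variable W : nat -> G -> set B.
Hypotheses (mW : forall r g, measurable (W r g))
  (W_shadow : forall r g x, shadow r g x -> W r g x)
  (shadow_W : forall r g x, W r g x -> shadow (r + 2 * D) g x)
  (W_quasi : forall r g (A : set B), measurable A ->
     m (A `&` W r g) <= lam ^+ (r + 2 * D) / lam ^+ len g * m (cact g @^-1` A)).

Let lam0 : 0 < lam. Proof. exact: lt_trans lam1. Qed.
Let C0 : 0 <= C.
Proof. by have := le_trans (s_ge 0) (s_le 0); rewrite expr0 mulr1; exact: le_trans. Qed.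

Lemma window_le r g : m (W r g) <= lam ^+ (r + 2 * D) / lam ^+ len g.
Proof.
have := @W_quasi r g setT measurableT; rewrite setTI => /le_trans; apply.
rewrite ler_piMr //; first by rewrite divr_ge0 // exprn_ge0 // ltW.
by apply: prob_le1; exact: cact_preimage_measurable.
Qed.

(** Elements of equal length whose enlarged shadows, of radius [r + 2 * D], share a point are within
    [r + 5 * D] of each other. *)
Lemma window_multiplicity r k (x : B) :
  (size [seq g <- sphere S k | x \in W r g] <= size (ball (r + 5 * D)))%N.
Proof.
case E : [seq g <- sphere S k | x \in W r g] => [|g0 s] //; rewrite -E.
have : g0 \in [seq g <- sphere S k | x \in W r g] by rewrite E mem_head.
rewrite mem_filter mem_sphere // => /andP[/set_mem/shadow_W sh0 /eqP l0].
rewrite -(size_map (fun g => g0^-1 * g)%g); apply: uniq_leq_size.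
  by rewrite map_inj_uniq; [exact/filter_uniq/sphere_uniq|exact: mulgI].
move=> _ /mapP[/= g + ->].
rewrite mem_filter mem_sphere // => /andP[/set_mem/shadow_W sh /eqP l].
rewrite mem_wball // -/(wdist S _ _).
by have := shadow_dist symS genS hypD sh0 sh; rewrite l0 l; lia.
Qed.

Lemma window_sum_le r k (Q : set B) : measurable Q ->
  \sum_(g <- sphere S k) m (Q `&` W r g) <= (size (ball (r + 5 * D)))%:R * m Q.
Proof.
move=> mQ.
have := @prob_sum_le _ B R mu G unit (sphere S k) [:: tt] (fun g => Q `&` W r g)
  (fun=> Q) (size (ball (r + 5 * D)))%:R.
rewrite big_seq1; apply=> // [g|x]; first exact: measurableI.
rewrite big_seq1 [in leRHS]indicE; case: (boolP (x \in Q)) => [Qx|nQx]; last first.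
  rewrite mulr0 big1 // => g _; rewrite indicE memNset // => -[/mem_set].
  by rewrite (negbTE nQx).
rewrite mulr1; apply: le_trans (_ : (size [seq g <- sphere S k | x \in W r g])%:R <= _).
  rewrite size_filter -sum1_count natr_sum [leRHS]big_mkcond /=.
  apply: ler_sum => g _; rewrite indicE in_setI Qx /=.
  by case: (x \in W r g).
by rewrite ler_nat window_multiplicity.
Qed.

Lemma window_compl_le n g :
  m (~` (cact g @^-1` W (2 * n) g)) <= lam ^+ (4 * D) / lam ^+ n.
Proof.
have mc : measurable (~` (cact g @^-1` W (2 * n) g) : set B).
  by apply: measurableC; exact: cact_preimage_measurable.
case: (shadow_compl symS genS hypD g n) => [H|[p lp H]].
  rewrite (_ : ~` _ = set0) ?prob0 ?divr_ge0 ?exprn_ge0 ?ltW //.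
  by apply/seteqP; split=> // x /=; apply; exact/W_shadow/H.
have := window_le (2 * D) p; rewrite lp -mulnDl => /(le_trans _); apply.
by apply: prob_le => // x /= nW; apply/W_shadow/H => /W_shadow.
Qed.

(** All of [Q] but a part of measure at most [lam ^+ (4 * D) / lam ^+ n] is sent by [g] into [Q] and
    the window at once; the translation inequality then bounds the measure of the image from
    below. *)
Lemma window_ge n g (Q : set B) : measurable Q -> cact g @^-1` Q = Q ->
  (m Q - lam ^+ (4 * D) / lam ^+ n) / lam ^+ len g <= m (Q `&` W (2 * n) g).
Proof.
move=> mQ invQ; rewrite ler_pdivrMr ?exprn_gt0 // [leRHS]mulrC.
apply: le_trans (quasi g (measurableI _ _ mQ (mW _ g))).
rewrite preimage_setI invQ.
have mP : measurable (cact g @^-1` W (2 * n) g : set B) by exact: cact_preimage_measurable.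
rewrite {1}(probDI mu mQ mP) lerBlDr addrC lerD2l.
apply: le_trans (window_compl_le n g); apply: prob_le.
- exact: measurableD.
- exact: measurableC.
- by move=> x [].
Qed.

(* The event that a ray, recentred at one of its points at time between [k - c]
   and [k], lies in [A]. *)
Definition transport r c k (A : set B) : set B :=
  [set x | exists2 g, g \in flatten [seq sphere S (k - i) | i <- iota 0 c.+1] &
           (W r g `&` cact g^-1%g @^-1` A) x].

Lemma transportP r c k A x : transport r c k A x <->
  exists g, [/\ (len g <= k)%N, (k <= len g + c)%N, W r g x & A (cact g^-1%g x)].
Proof.
split=> [[g /flattenP[_ /mapP[i + ->]]]|[g [lk kl Wx Ax]]].
  rewrite mem_iota mem_sphere //= add0n ltnS => ic /eqP lg [Wx Ax].
  by exists g; split=> //; rewrite lg; lia.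
exists g => //; apply/flattenP; exists (sphere S (len g)); last by rewrite mem_sphere.
apply/mapP; exists (k - len g)%N; last by rewrite subKn.
by rewrite mem_iota add0n ltnS leq0n leq_subLR.
Qed.

Lemma transport_measurable r c k A : measurable A -> measurable (transport r c k A).
Proof.
move=> mA; apply: (prob_bigcup_le mu _ _).1 => g.
by apply: measurableI => //; exact: cact_preimage_measurable.
Qed.

(** The sphere of radius [j] has at most [C * lam ^+ j] elements, and each contributes at most a
    constant times [m A / lam ^+ j]. The powers cancel, so the bound does not depend on [k]. *)
Lemma transport_le r c k A : measurable A ->
  m (transport r c k A) <= c.+1%:R * C * lam ^+ (r + 2 * D) * m A.
Proof.
move=> mA; apply: le_trans (prob_bigcup_le mu _ _).2 _ => [g|].
  by apply: measurableI => //; exact: cact_preimage_measurable.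
rewrite big_flatten big_map.
have -> : c.+1%:R * C * lam ^+ (r + 2 * D) * m A =
    \sum_(i <- iota 0 c.+1) C * lam ^+ (r + 2 * D) * m A.
  by rewrite big_const_seq count_predT size_iota iter_addr_0 -[RHS]mulr_natl !mulrA.
apply: ler_sum => i _; set j := (k - i)%N.
apply: le_trans (_ : \sum_(g <- sphere S j) lam ^+ (r + 2 * D) / lam ^+ j * m A <= _).
  rewrite [leLHS]big_seq [leRHS]big_seq; apply: ler_sum => g.
  rewrite mem_sphere // => /eqP <-; rewrite setIC.
  apply: le_trans (W_quasi r g (cact_preimage_measurable symS genS g^-1%g mA)) _.
  rewrite -comp_preimage (_ : _ \o _ = id) //; apply/funext => x /=.
  by rewrite cactK.
rewrite big_const_seq count_predT iter_addr_0 -[leLHS]mulr_natl !mulrA ler_wpM2r ?prob_ge0 //.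
have L0 : 0 <= lam ^+ (r + 2 * D) by rewrite exprn_ge0 // ltW.
by rewrite ler_pdivrMr ?exprn_gt0 // [leRHS]mulrAC ler_wpM2r.
Qed.

(* The windows at a large time are almost contained in [A] or in its complement:
   this is preserved by the operations of a sigma-algebra, and serves as a
   density theorem. *)
Let split r (A : set B) := measurable A /\ forall e, 0 < e -> exists K, forall k, (K <= k)%N ->
  \sum_(g <- sphere S k) Num.min (m (A `&` W r g)) (m (W r g `\` A)) <= e.

Let split_open r U : open_set R U -> split r U.
Proof.
move=> oU; have mU := open_set_measurable oU; split=> // e e0.
pose M : R := (size (ball (r + 5 * D)))%:R.
(* The points of [U] in a window that sticks out of [U]. As windows shrink, each point of [U]
   belongs to finitely many of these sets. *)
pose V k : set B := [set x | exists2 g, g \in sphere S k &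
  (U `&` W r g `&` [set _ | ~ (W r g `<=` U)]) x].
have mP (P : Prop) : measurable ([set _ | P] : set B).
  by have [p|np] := pselect P; [rewrite (_ : mkset _ = setT)|rewrite (_ : mkset _ = set0)];
    rewrite //; apply/seteqP; split.
have mV k : measurable (V k).
  apply: (prob_bigcup_le mu _ _).1 => g; apply: measurableI => //.
  exact: measurableI.
pose F k := \bigcup_(j in [set j | (k <= j)%N]) V j.
have mF k : measurable (F k) by apply: bigcup_measurable => j _.
have e1 : 0 < e / (M + 1) by rewrite divr_gt0 // ltr_wpDl.
have [|x|n hn] := prob_vanish mu mF _ _ e1.
- by move=> n x [k /= /ltnW nk Vk]; exists k.
- have [Ux|nUx] := pselect (U x); last by exists 0%N => -[k _ [g _ [[]]]].
  have [n hn] := (open_setP symS genS R U).1 oU _ Ux.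
  exists (n + r + 3 * D)%N => -[k /= nk [g]]; rewrite mem_sphere // => /eqP lg.
  move=> [[_ /shadow_W Wx]] /=; apply=> y /shadow_W Wy; apply: hn.
  by apply: (bnear_shadow symS genS hypD Wx Wy); lia.
exists n => k nk; have -> : e = (M + 1) * (e / (M + 1)).
  by rewrite mulrC divfK // gt_eqF // ltr_wpDl.
apply: (@le_trans _ _ (M * m (V k))); last first.
  apply: ler_pM => //; [exact: prob_ge0|by rewrite lerDl|apply: le_trans (ltW hn)].
  by apply: prob_le => // x Vx; exists k.
apply: le_trans (window_sum_le r k (mV k)).
rewrite [leLHS]big_seq [leRHS]big_seq; apply: ler_sum => g gk.
have [sub|nsub] := pselect (W r g `<=` U).
  rewrite ge_min; apply/orP; right.
  rewrite (_ : _ `\` _ = set0) ?prob0 ?prob_ge0 //.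
  by apply/seteqP; split=> // x [/sub].
rewrite ge_min; apply/orP; left; apply: prob_le; try exact: measurableI.
by move=> x [Ux Wx]; split=> //; exists g.
Qed.

Let splitC r A : split r A -> split r (~` A).
Proof.
move=> [mA H]; split; first exact: measurableC.
move=> e /H[K HK]; exists K => k /HK; apply: le_trans.
by apply: ler_sum => g _; rewrite minC setIC -setDE setDE setCK setIC.
Qed.

Let splitU r A A' : split r A -> split r A' -> split r (A `|` A').
Proof.
move=> [mA HA] [mA' HA']; split; first exact: measurableU.
move=> e e0; have e2 : 0 < e / 2 by rewrite divr_gt0.
have [K HK] := HA _ e2; have [K' HK'] := HA' _ e2.
exists (maxn K K') => k; rewrite geq_max => /andP[/HK h /HK' h'].
rewrite [e]splitr; apply: le_trans (lerD h h'); rewrite -big_split /=.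
apply: ler_sum => g _.
have mAW := measurableI _ _ mA (mW r g); have mA'W := measurableI _ _ mA' (mW r g).
have mWA := measurableD (mW r g) mA; have mWA' := measurableD (mW r g) mA'.
have mUA := measurableU _ _ mA mA'.
have d1 : m (W r g `\` (A `|` A')) <= m (W r g `\` A).
  apply: prob_le => //; first exact: measurableD.
  by apply: setDS; exact: subsetUl.
have d2 : m (W r g `\` (A `|` A')) <= m (W r g `\` A').
  apply: prob_le => //; first exact: measurableD.
  by apply: setDS; exact: subsetUr.
have d3 : m ((A `|` A') `&` W r g) <= m (A `&` W r g) + m (A' `&` W r g).
  by rewrite setIUl; exact: probU.
have := prob_ge0 mu (A `&` W r g); have := prob_ge0 mu (A' `&` W r g).
have := prob_ge0 mu (W r g `\` A); have := prob_ge0 mu (W r g `\` A').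
move: d1 d2 d3; move: (m (A `&` W r g)) (m (A' `&` W r g)) (m (W r g `\` A))
  (m (W r g `\` A')) (m ((A `|` A') `&` W r g)) (m (W r g `\` (A `|` A'))).
move=> a a' b b' c d d1 d2 d3 b'0 b0 a'0 a0.
by case: (leP a b) => ?; case: (leP a' b') => ?; case: (leP c d) => ?; lra.
Qed.

Let split_measurable r A : measurable A -> split r A.
Proof.
move=> mA; apply: (borel_induction (P := split r)) mA; [exact: split_open|exact: splitC|].
move=> F HF; have mU : measurable (\bigcup_n F n).
  by apply: bigcup_measurable => n _; have [] := HF n.
have HN n : split r (\big[setU/set0]_(k < n) F k).
  elim: n => [|n IH]; first by rewrite big_ord0; apply: split_open => x.
  by rewrite big_ord_recr; exact: splitU.
split=> // e e0; have e2 : 0 < e / 2 by rewrite divr_gt0.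
pose M : R := (size (ball (r + 5 * D)))%:R.
pose V n := \bigcup_n F n `\` \big[setU/set0]_(k < n) F k.
have mV n : measurable (V n) by apply: measurableD => //; have [] := HN n.
have e1 : 0 < e / 2 / (M + 1) by rewrite divr_gt0 // ltr_wpDl.
have [|x|n hn] := prob_vanish mu mV _ _ e1.
- by move=> n; apply: setDS; rewrite big_ord_recr; exact: subsetUl.
- have [[n _ Fnx]|nx] := pselect ((\bigcup_n F n) x); last by exists 0%N => -[].
  by exists n.+1 => -[_]; apply; rewrite big_ord_recr; right.
have [mN /(_ _ e2)[K HK]] := HN n; exists K => k /HK h.
set N := \big[setU/set0]_(k < n) F k in mN h V mV hn.
have NU : N `<=` \bigcup_n F n.
  by move=> x; rewrite /N -bigcup_mkord => -[j _ Fjx]; exists j.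
have le2 : M * m (V n) <= e / 2.
  have -> : e / 2 = (M + 1) * (e / 2 / (M + 1)).
    by rewrite [RHS]mulrC divfK // gt_eqF // ltr_wpDl.
  by apply: ler_pM => //; [exact: prob_ge0|rewrite lerDl|exact: ltW].
rewrite [e]splitr; apply: le_trans (lerD h (le_trans (window_sum_le r k (mV n)) le2)).
rewrite -big_split /=; apply: ler_sum => g _.
have d1 : m (W r g `\` \bigcup_n F n) <= m (W r g `\` N).
  by apply: prob_le; [exact: measurableD|exact: measurableD|exact: setDS].
have d2 : m (\bigcup_n F n `&` W r g) <= m (N `&` W r g) + m (V n `&` W r g).
  have mNW := measurableI _ _ mN (mW r g); have mVW := measurableI _ _ (mV n) (mW r g).
  apply: le_trans (probU mu mNW mVW); apply: prob_le; [exact: measurableI|exact: measurableU|].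
  by move=> x [Ux Wx]; have [Nx|nNx] := pselect (N x); [left|right].
have := prob_ge0 mu (V n `&` W r g).
move: d1 d2; move: (m (V n `&` W r g)) (m (N `&` W r g)) (m (W r g `\` N))
  (m (\bigcup_n F n `&` W r g)) (m (W r g `\` \bigcup_n F n)).
move=> v a b c d d1 d2 v0.
by case: (leP a b) => ?; case: (leP c d) => ?; lra.
Qed.

Lemma geometric_small e : 0 < e -> exists n, lam ^+ (4 * D) / lam ^+ n <= e.
Proof.
move=> e0; have q1 : `|lam^-1| < 1 by rewrite ger0_norm ?invf_lt1 // invr_ge0 ltW.
have L0 : 0 < lam ^+ (4 * D) by rewrite exprn_gt0.
have /cvgrPdist_lt/(_ _ (divr_gt0 e0 L0))[n _ /(_ n (leqnn n))] := cvg_expr q1.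
rewrite /= sub0r normrN ger0_norm ?exprn_ge0 ?invr_ge0 ?ltW // => /ltW.
by rewrite ler_pdivlMr // mulrC exprVn => ?; exists n.
Qed.

(** If neither [A] nor its complement is null, both fill at least [delta / lam ^+ k] of each window
    of level [k]. There are at least [lam ^+ k] such windows, so the sum of the minima stays above
    [delta], against the density property. *)
Lemma ergodic (A : set B) : measurable A -> (forall g x, A x -> A (cact g x)) ->
  m A = 0 \/ m A = 1.
Proof.
move=> mA invA; apply: contrapT => /not_orP[/eqP mA0 /eqP mA1].
have invP g : cact g @^-1` A = A.
  apply/seteqP; split=> x /=; last exact: invA.
  by move=> /(invA g^-1%g); rewrite cactK.
have mA_gt0 : 0 < m A by rewrite lt_neqAle eq_sym mA0 prob_ge0.
have mC_gt0 : 0 < m (~` A) by rewrite probC // subr_gt0 lt_neqAle mA1 prob_le1.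
pose delta := Num.min (m A) (m (~` A)) / 2.
have d0 : 0 < delta by rewrite divr_gt0 // lt_min mA_gt0.
have dA : delta + delta <= m A by rewrite -splitr ge_min lexx.
have dC : delta + delta <= m (~` A) by rewrite -splitr ge_min lexx orbT.
have [n hn] := geometric_small d0.
have low (Q : set B) k g : measurable Q -> cact g @^-1` Q = Q -> delta + delta <= m Q ->
    g \in sphere S k -> delta / lam ^+ k <= m (Q `&` W (2 * n) g).
  move=> mQ invQ dQ; rewrite mem_sphere // => /eqP <-.
  apply: le_trans (window_ge n mQ invQ).
  by rewrite ler_wpM2r ?invr_ge0 ?exprn_ge0 ?(ltW lam0) //; lra.
have [_ /(_ (delta / 2))[|K /(_ K (leqnn K))]] := split_measurable (2 * n) mA.
  by rewrite divr_gt0.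
apply/negP; rewrite -ltNge; apply: (@lt_le_trans _ _ delta).
  by rewrite ltr_pdivrMr // mulr_natr mulr2n ltrDl.
apply: (@le_trans _ _ (\sum_(g <- sphere S K) delta / lam ^+ K)).
  rewrite big_const_seq count_predT iter_addr_0 -[leRHS]mulr_natl mulrA mulrAC.
  by rewrite ler_peMl ?(ltW d0) // ler_pdivlMr ?exprn_gt0 // mul1r.
rewrite [leLHS]big_seq [leRHS]big_seq; apply: ler_sum => g gK.
rewrite le_min low //= setDE setIC low //; first exact: measurableC.
by rewrite -preimage_setC invP.
Qed.

(** Both windows lie in shadows of radius [3 * D]; their product has radius [3 * D + 3 * D + 2 * D],
    which is also the possible loss of length. This is why [transport] has a time slack. *)
Lemma transport_mul j k g (Q : set B) x : len g = j -> W D g x ->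
  transport D 0 k Q (cact g^-1%g x) -> transport (8 * D) (8 * D) (j + k) Q x.
Proof.
move=> lg Wx /transportP[h [hk kh Wh Qh]].
have [sh ln] := shadow_mul symS genS hypD (shadow_W Wx) (shadow_W Wh).
apply/transportP; exists (g * h)%g; split.
- by have := wordlenM genS g h; glia.
- by move: ln; glia.
- by apply: W_shadow; apply: shadowW sh; lia.
- by rewrite ginvM cactM.
Qed.

(** For [N] large, at each time most points have a recentring whose interval of density [eta] has
    length at most [N]. The covering lemma along a ray, integrated, bounds [eta * (N + 1) / 2] by
    [2 * (N + 1) * K0 * m Q], whence the constant [4 * K0]. *)
Lemma maximal_inequality : exists2 K : R, 0 <= K & forall (Q Om : set B) (eta : R),
  measurable Q -> measurable Om -> m Om = 1 ->
  (forall x, Om x -> exists xi, x = Bd xi) -> (forall g x, Om x -> Om (cact g x)) ->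
  0 <= eta ->
  (forall x, Om x -> exists2 n, (0 < n)%N &
     eta * n%:R <= \sum_(0 <= k < n) \1_(transport D 0 k Q) x) ->
  eta <= K * m Q.
Proof.
pose K0 := (8 * D).+1%:R * C * lam ^+ (8 * D + 2 * D).
pose K1 := 1%:R * C * lam ^+ (D + 2 * D).
have L0 n : 0 <= lam ^+ n by rewrite exprn_ge0 // ltW.
have K00 : 0 <= K0 by rewrite !mulr_ge0.
have K10 : 0 <= K1 by rewrite !mulr_ge0.
exists (4 * K0); first by rewrite mulr_ge0.
move=> Q Om eta mQ mOm Om1 Ombd Ominv eta0 H.
have mT r c k (A : set B) : measurable A -> measurable (transport r c k A).
  exact: transport_measurable.
pose good n : set B := [set x | eta * n%:R <= \sum_(0 <= k < n) (\1_(transport D 0 k Q) x : R)].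
have mgood n : measurable (good n).
  have : measurable_fun setT
      (fun x : B => \sum_(0 <= k < n) (\1_(transport D 0 k Q) x : R)).
    by apply: measurable_sum => k; apply: measurable_indic; exact: mT.
  move/(_ measurableT _ (measurable_itv `[eta * n%:R, +oo[)); rewrite setTI.
  congr (_ _); apply/seteqP; split=> x; rewrite /good /= in_itv /= andbT //.
(* Points of [Om] with no interval of length at most [N]; for [N] large even the transports of this
   set have measure at most 1/2. *)
pose F N := Om `\` \bigcup_(n in [set n | (0 < n <= N)%N]) good n.
have mF N : measurable (F N).
  by apply: measurableD => //; apply: bigcup_measurable => n _.
have e1 : 0 < 1 / (2 * (K1 + 1)) by rewrite divr_gt0 // mulr_gt0 // ltr_wpDl.
have [|x|N /ltW hN] := prob_vanish mu mF _ _ e1.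
- move=> n; apply: setDS => x [k /andP[k0 kn] xk]; exists k => //.
  by rewrite /= k0 leqW.
- have [Omx|nOmx] := pselect (Om x); last by exists 0%N => -[].
  by have [n n0 hn] := H x Omx; exists n => -[_]; apply; exists n; rewrite //= n0 leqnn.
have small j : m (transport D 0 j (F N)) <= 1 / 2.
  apply: le_trans (transport_le _ _ _ (mF N)) _.
  apply: (@le_trans _ _ ((K1 + 1) * (1 / (2 * (K1 + 1))))).
    by apply: ler_pM => //; [exact: prob_ge0|rewrite lerDl].
  by rewrite invfM mul1r mulrCA divff ?mulr1 ?mul1r // gt_eqF // ltr_wpDl.
(* Recentring a point of [J j] at any admissible element of length [j] gives an interval of length
   at most [N]. *)
pose J j := Om `\` transport D 0 j (F N).
have mJ j : measurable (J j) by apply: measurableD => //; exact: mT.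
have J_ge j : 1 / 2 <= m (J j).
  have := probDI mu mOm (mT D 0%N j _ (mF N)); rewrite Om1 -/(J j).
  have := small j; have : m (Om `&` transport D 0 j (F N)) <= m (transport D 0 j (F N)).
    by apply: prob_le; [apply: measurableI => //; exact: mT|exact: mT|move=> x []].
  lra.
pose T i := transport (8 * D) (8 * D) i Q.
have cover x : eta * \sum_(0 <= j < N.+1) (\1_(J j) x : R) <=
    \sum_(0 <= i < N.+1 + N) (\1_(T i) x : R).
  apply: (@covering _ (fun j => \1_(J j) x) (fun i => \1_(T i) x)) => // j.
  have [[Omx nTx]|nJ] := pselect (J j x); last by left; rewrite indicE memNset.
  right; have [xi xE] := Ombd x Omx.
  have [g lg sg] := shadow_ex symS genS hypD xi j; rewrite -xE in sg.
  have Wx := W_shadow sg.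
  have [n /andP[n0 nN] hn] : (\bigcup_(n in [set n | (0 < n <= N)%N]) good n)
      (cact g^-1%g x).
    apply: contrapT => nG; apply: nTx; apply/transportP.
    exists g; split=> //; rewrite ?lg ?addn0 //; split=> //.
    exact: Ominv.
  exists n; split=> //; apply: le_trans hn _.
  have -> : \sum_(j <= i < j + n) (\1_(T i) x : R) = \sum_(0 <= i < n) \1_(T (i + j)%N) x.
    by rewrite -{1}[j]add0n big_addn addKn.
  apply: ler_sum => k _; rewrite !indicE.
  case: (boolP (_ \in _)) => [/set_mem tk|_]; last by case: (_ \in _); rewrite ?ler01.
  by rewrite mem_set // addnC; exact: (transport_mul lg Wx tk).
have [->|eta_neq0] := eqVneq eta 0.
  by rewrite !mulr_ge0 // prob_ge0.
have eta_gt0 : 0 < eta by rewrite lt_neqAle eq_sym eta_neq0.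
have := @prob_sum_le _ B R mu nat nat (index_iota 0 N.+1) (index_iota 0 (N.+1 + N)) J T eta^-1.
rewrite invr_ge0 => /(_ eta0 mJ (fun i => mT _ _ i _ mQ)) le_JT.
have {}le_JT : eta * (N.+1%:R * (1 / 2)) <= (N.+1 + N)%:R * (K0 * m Q).
  apply: (@le_trans _ _ (eta * \sum_(0 <= j < N.+1) m (J j))).
    rewrite ler_wpM2l //; apply: le_trans (ler_sum _ (fun j _ => J_ge j)).
    by rewrite big_const_nat subn0 iter_addr_0 -[leRHS]mulr_natl.
  rewrite -ler_pdivlMl // ; apply: le_trans (le_JT _) _.
    by move=> x; rewrite ler_pdivlMl.
  rewrite ler_wpM2l ?invr_ge0 //.
  apply: le_trans (ler_sum _ (fun i _ => transport_le _ _ i mQ)) _.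
  by rewrite big_const_nat subn0 iter_addr_0 -[leLHS]mulr_natl.
have le2 : (N.+1 + N)%:R * (K0 * m Q) <= (2 * N.+1%:R) * (K0 * m Q).
  by rewrite ler_wpM2r ?mulr_ge0 ?prob_ge0 // -natrM ler_nat mul2n -addnn leq_add2l.
have N0 : 0 < N.+1%:R :> R by rewrite ltr0n.
rewrite -(ler_pM2l N0); have := le_trans le_JT le2.
by move: (N.+1%:R) (m Q) => a q; lra.
Qed.

(** * Sets of boundary points with large upper slope *)

Definition boundary : set B := [set x | exists xi, x = Bd xi].

Lemma boundary_measurable : measurable boundary.
Proof.
rewrite (_ : boundary = ~` [set x | exists g, x = Pt S g]).
  apply: measurableC; apply: open_set_measurable.
  apply/(open_setP symS genS) => _ [g ->]; exists (2 * len g).+1 => y.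
  by move=> /(bnear_pt genS) -> //; exists g.
apply/seteqP; split=> [_ [xi ->] [g]//|[g|xi] /=]; last by move=> _; exists xi.
by case; exists g.
Qed.

Lemma boundary_cact g x : boundary x -> boundary (cact g x).
Proof. by move=> [xi ->]; exists (bact g xi). Qed.

Lemma shadow_cact r g h (x : X) :
  shadow r g x -> shadow (r + 2 * len h) (h * g)%g (cact h x).
Proof.
move=> [b xb [N H]]; exists (fun n => h * b n)%g; first exact: represents_cact.
exists N => j /H; rewrite wdistMl.
have := wordlenM genS h g; have := len_mul_ge symS genS h (b j); glia.
Qed.

(** The summand 1 leaves room for [phi 1], which is nonnegative but may be positive. *)
Definition word_lipschitz (c : R) (psi : G -> R) :=
  forall u v, `|psi u - psi v| <= c * ((dist u v)%:R + 1).

(** Unlike subadditivity this passes to [- phi], so one zero-one law covers the upper and the lower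
    limit. *)
Definition left_coarse (psi : G -> R) :=
  forall h, exists c, forall g : G, `|psi (h * g)%g - psi g| <= c.

(* The boundary points along which the upper limit of [psi g / len g] exceeds [t]. *)
Definition above (psi : G -> R) (t : R) : set B := boundary `&`
  [set x | exists2 s, t < s & forall N, exists2 k, (N <= k)%N & exists g : G,
     [/\ len g = k, W D g x & k%:R * s < psi g]].

(** Replacing [s] by the midpoint of [t] and [s] gains a multiple of [k], which absorbs the constant
    [c] for large [k]. *)
Lemma aboveI psi t s c x : boundary x -> t < s ->
  (forall N, exists2 k, (N <= k)%N & exists g : G,
     [/\ len g = k, W D g x & k%:R * s <= psi g + c]) -> above psi t x.
Proof.
move=> bx ts H; split=> //; have [ts1 ts2] := midf_lt ts.
exists ((t + s) / 2) => // N.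
have [k kN [g [lg Wx gx]]] := H (N + (Num.bound (`|c| / ((s - t) / 2))))%N.
exists k; first exact: leq_trans (leq_addr _ _) kN.
exists g; split=> //.
have d0 : 0 < (s - t) / 2 by rewrite divr_gt0 // subr_gt0.
have : `|c| / ((s - t) / 2) < k%:R.
  apply: lt_le_trans (_ : (Num.bound (`|c| / ((s - t) / 2)))%:R <= _).
    by rewrite archi_boundP // divr_ge0 // ltW.
  by rewrite ler_nat (leq_trans (leq_addl _ _) kN).
rewrite ltr_pdivrMr //; have := ler_norm c.
move: gx; move: (k%:R) (psi g) (`|c|) => a b d; nra.
Qed.

Lemma above_measurable psi t : measurable (above psi t).
Proof.
apply: measurableI; first exact: boundary_measurable.
pose U e k := [set x : B | exists2 g, g \in [seq g <- sphere S k |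
  k%:R * (t + e.+1%:R^-1) < psi g] & W D g x].
(* The real [s] may be taken of the form [t + 1 / (e + 1)], which makes the union countable. *)
rewrite (_ : mkset _ = \bigcup_e \bigcap_N \bigcup_(k in [set k | (N <= k)%N]) U e k).
  apply: bigcup_measurable => e _; apply: bigcap_measurable => // N _.
  apply: bigcup_measurable => k _; exact: (prob_bigcup_le mu _ _).1.
apply/seteqP; split=> x /=.
  move=> [s ts H]; have st0 : 0 < s - t by rewrite subr_gt0.
  have /cvgrPdist_lt/(_ _ st0)[e _ /(_ e (leqnn e))] := @cvg_harmonic R.
  rewrite /= sub0r normrN ger0_norm ?invr_ge0 // => he; rewrite /= in he.
  have {}he : (e.+1%:R^-1 : R) < s - t := he.
  exists e => // N _; have [k kN [g [lg Wx gx]]] := H N; exists k => //.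
  exists g => //; rewrite mem_filter mem_sphere // lg eqxx andbT.
  by apply: le_lt_trans gx; rewrite ler_wpM2l // ltW // -ltrBrDl.
move=> [e _ H]; exists (t + e.+1%:R^-1); first by rewrite ltrDl invr_gt0.
move=> N; have [k kN [g]] := H N I; rewrite mem_filter mem_sphere // => /andP[gx /eqP lg] Wx.
by exists k => //; exists g.
Qed.

Lemma above_cact psi t c h x : word_lipschitz c psi -> 0 <= c -> left_coarse psi ->
  above psi t x -> above psi t (cact h x).
Proof.
move=> lip c0 lc [bx [s ts H]]; have [ch hch] := lc h.
have bhx := boundary_cact h bx; have [xi hxE] := bhx.
(* Translation enlarges the shadow radius [3 * D] by [2 * len h] and changes the length by at most
   [len h]; comparing two shadows adds [3 * D]. *)
apply: (@aboveI psi t s (ch + c * ((6 * D + 3 * len h)%:R + 1))) => // N.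
have [k kN [g [lg Wx gx]]] := H N; exists k => //.
have [g' lg' sg'] := shadow_ex symS genS hypD xi k; rewrite -hxE in sg'.
exists g'; split=> //; first exact: W_shadow.
have dg : (dist (h * g)%g g' <= 6 * D + 3 * len h)%N.
  have := shadow_dist symS genS hypD (shadow_cact h (shadow_W Wx)) sg'.
  have := wordlenM genS h g; have := len_mul_ge symS genS h g; rewrite lg lg'; glia.
have h1 := lip (h * g)%g g'.
have h2 : c * ((dist (h * g)%g g')%:R + 1) <= c * ((6 * D + 3 * len h)%:R + 1).
  by rewrite ler_wpM2l // lerD2r ler_nat.
have h3 := hch g; have h4 := ler_norm (psi (h * g)%g - psi g').
have h5 := ler_norm (- (psi (h * g)%g - psi g)); rewrite normrN in h5; lra.
Qed.

Lemma above_01 psi t c : word_lipschitz c psi -> 0 <= c -> left_coarse psi ->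
  m (above psi t) = 0 \/ m (above psi t) = 1.
Proof.
move=> lip c0 lc; apply: ergodic; first exact: above_measurable.
by move=> g x; apply: above_cact lip c0 lc.
Qed.

(** * Existence and sign of the drift *)

Section Subadditive.
Variables (phi : G -> R) (c : R).
Hypotheses (c0 : 0 <= c) (lip : word_lipschitz c phi) (sub : subadditive_fun phi).

Lemma subadditive_left_coarse : left_coarse phi.
Proof.
move=> h; exists (`|phi h| + `|phi h^-1%g|) => g.
have h1 := sub h g; have := sub h^-1%g (h * g)%g; rewrite mulKg => h2.
have h3 := ler_norm (phi h); have h4 := ler_norm (phi h^-1%g).
have := normr_ge0 (phi h); have := normr_ge0 (phi h^-1%g).
by rewrite ler_norml => ? ?; apply/andP; split; lra.
Qed.

Lemma lipschitzN : word_lipschitz c (fun g => - phi g).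
Proof. by move=> u v; rewrite -opprD normrN; exact: lip. Qed.

Lemma left_coarseN : left_coarse (fun g => - phi g).
Proof.
move=> h; have [c' hc'] := subadditive_left_coarse h; exists c' => g.
by rewrite -opprD normrN.
Qed.

Lemma lipschitz_dist u v n : (dist u v <= n)%N -> phi u <= phi v + c * (n%:R + 1).
Proof.
move=> le_n; rewrite -lerBlDl; apply: le_trans (ler_norm _) _.
by apply: le_trans (lip u v) _; rewrite ler_wpM2l // lerD2r ler_nat.
Qed.

(* The margin [c1] absorbs the distance between a geodesic and the
   concatenation of two geodesic segments that follow it. *)
Let slow (s c1 : R) (N : nat) : set B := [set x | exists2 l, (0 < l <= N)%N &
  exists g : G, [/\ len g = l, W D g x & phi g + c1 <= l%:R * s]].

Let slow_measurable s c1 N : measurable (slow s c1 N).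
Proof.
pose U l := [set x : B | exists2 g, g \in [seq g <- sphere S l | phi g + c1 <= l%:R * s]
  & W D g x].
rewrite (_ : slow _ _ _ = \bigcup_(l in [set l | (0 < l <= N)%N]) U l).
  by apply: bigcup_measurable => l _; exact: (prob_bigcup_le mu _ _).1.
apply/seteqP; split=> x /=.
  move=> [l lN [g [lg Wx gx]]]; exists l => //; exists g => //.
  by rewrite mem_filter gx mem_sphere // lg eqxx.
move=> [l lN [g]]; rewrite mem_filter mem_sphere // => /andP[gx /eqP lg] Wx.
by exists l => //; exists g.
Qed.

(* Following Katznelson and Weiss: a ray is cut into slow segments and bad
   points, and the maximal inequality bounds the density of the latter. *)
Lemma above_disjoint s t : s < t -> m (above phi t) = 1 ->
  m (above (fun g => - phi g) (- s)) = 1 -> False.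
Proof.
move=> st m1 m2.
pose Om := above phi t `&` above (fun g => - phi g) (- s).
have mA := above_measurable phi t; have mA' := above_measurable (fun g => - phi g) (- s).
have mOm : measurable Om by exact: measurableI.
have Om1 : m Om = 1.
  have := probDI mu mA mA'; rewrite -/Om m1.
  have : m (above phi t `\` above (fun g => - phi g) (- s)) <=
      m (~` above (fun g => - phi g) (- s)).
    by apply: prob_le => [||x []//]; [exact: measurableD|exact: measurableC].
  rewrite (probC mu mA') m2 subrr.
  by have := prob_ge0 mu (above phi t `\` above (fun g => - phi g) (- s)); lra.
have Ominv g x : Om x -> Om (cact g x).
  move=> [Ax A'x]; split; first by apply: above_cact lip c0 subadditive_left_coarse Ax.
  by apply: above_cact lipschitzN c0 left_coarseN A'x.
have Ombd x : Om x -> exists xi, x = Bd xi by move=> [[bx _] _].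
(* A product of two chosen points has shadow radius [8 * D] and a length defect up to [8 * D];
   comparison with the chosen point of the full length adds [3 * D], in all [19 * D]. Points chosen
   at consecutive times are within [1 + D + 3 * D]. *)
pose c1 := c * ((19 * D)%:R + 1); pose c2 := c * ((4 * D + 1)%:R + 1).
have c10 : 0 <= c1 by rewrite mulr_ge0 // addr_ge0.
have c20 : 0 <= c2 by rewrite mulr_ge0 // addr_ge0.
pose Q N := Om `\` slow s c1 N.
have mQ N : measurable (Q N) by exact: measurableD.
pose c3 := c2 + `|s| + 1; have c30 : 0 < c3 by rewrite ltr_wpDl // addr_ge0.
(* Half of the density that the gap [t - s] forces on the bad times; the other half absorbs the
   bounded terms for large [n]. *)
pose eta := (t - s) / (2 * c3).
have eta0 : 0 < eta by rewrite divr_gt0 ?mulr_gt0 // subr_gt0.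
have [K K0 hK] := maximal_inequality.
have eta_le N : eta <= K * m (Q N).
  apply: (hK _ Om) => //; first exact: ltW.
  move=> x Omx; have [xi xE] := Ombd x Omx.
  have /choice[p hp] k : exists g, len g = k /\ shadow D g x.
    by have [g lg sg] := shadow_ex symS genS hypD xi k; exists g; rewrite xE.
  pose b k : R := \1_(transport D 0 k (Q N)) x.
  have chunk n : phi (p n) <= phi (p 0%N) + n%:R * s +
      (c2 + `|s|) * (\sum_(0 <= k < n) b k + N%:R).
    apply: (@chunking R (fun k => phi (p k)) b) => // k.
      have [lk sk] := hp k; have [lk1 sk1] := hp k.+1.
      apply: lipschitz_dist; have := shadow_dist symS genS hypD sk1 sk.
      by rewrite lk lk1; clear; lia.
    have [lk sk] := hp k; have Wk := W_shadow sk.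
    have [tk|ntk] := pselect (transport D 0 k (Q N) x).
      by left; rewrite /b indicE mem_set.
    right; have [l /andP[l0 lN] [g [lg Wg gl]]] : slow s c1 N (cact (p k)^-1%g x).
      apply: contrapT => nsl; apply: ntk; apply/transportP; exists (p k).
      by split; rewrite ?lk ?addn0 //; split=> //; exact: Ominv.
    exists l; split=> //.
    have [skg lkg] := shadow_mul symS genS hypD (shadow_W Wk) (shadow_W Wg).
    have [lkl skl] := hp (k + l)%N.
    have : phi (p (k + l)%N) <= phi (p k * g)%g + c1.
      apply: lipschitz_dist; have := shadow_dist symS genS hypD skl skg.
      have := wordlenM genS (p k) g; move: lkg; rewrite lkl lk lg; clear; glia.
    have := sub (p k) g; lra.
  have [[_ [t' tt' Ht']] _] := Omx.
  pose c4 := c * ((6 * D)%:R + 1).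
  pose big := 2 * (`|c4| + `|phi (p 0%N)| + c3 * N%:R) / (t - s).
  (* At such a time the slope exceeds [t], whereas chunking allows slope [s] plus the bad times; so
     these make up a proportion at least [eta]. *)
  have [n nN [g [lg Wg gn]]] := Ht' (Num.bound big).+1.
  have n0 : (0 < n)%N by exact: leq_trans nN.
  exists n => //; rewrite -/(b _).
  have [ln sn] := hp n.
  have hg : phi g <= phi (p n) + c4.
    apply: lipschitz_dist; have := shadow_dist symS genS hypD (shadow_W Wg) sn.
    by rewrite lg ln; clear; lia.
  have ts0 : 0 < t - s by rewrite subr_gt0.
  have : big < n%:R.
    apply: lt_le_trans (_ : (Num.bound big)%:R <= _); last by rewrite ler_nat ltnW.
    rewrite archi_boundP // divr_ge0 ?(ltW ts0) // mulr_ge0 // !addr_ge0 //.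
    by rewrite mulr_ge0 // ltW.
  rewrite ltr_pdivrMr // => hbig.
  have nt : n%:R * t <= n%:R * t' by rewrite ler_wpM2l // ltW.
  have S0 : 0 <= \sum_(0 <= k < n) b k + N%:R.
    by rewrite addr_ge0 // sumr_ge0.
  have := chunk n; have := ler_norm c4; have := ler_norm (phi (p 0%N)).
  rewrite /eta mulrAC ler_pdivrMr ?mulr_gt0 //.
  move: S0; rewrite /c3 in hbig *.
  change (\sum_(0 <= k < n) \1_(transport D 0 k (Q N)) x) with (\sum_(0 <= k < n) b k).
  move: (\sum_(0 <= k < n) b k) => sb S0 a1 a2 a3; rewrite /c3; nra.
have e1 : 0 < eta / (K + 1) by rewrite divr_gt0 // ltr_wpDl.
have [|x|N hN] := prob_vanish mu mQ _ _ e1.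
- by move=> N; apply: setDS => x [l /andP[l0 lN] hl]; exists l => //; rewrite l0 leqW.
(* A lower limit below [s] provides, for each point of [Om], a slow initial segment long enough to
   pay for the margin [c1]. Hence the sets [Q N] decrease to nothing. *)
- have [Omx|nOmx] := pselect (Om x); last by exists 0%N => -[].
  have [_ [_ [s' ss' Hs]]] := Omx.
  pose big := c1 / (s' + s).
  have ss0 : 0 < s' + s by lra.
  have [l lN [g [lg Wg gl]]] := Hs (Num.bound big).+1.
  exists l => -[_]; apply; exists l; first by rewrite leqnn andbT (leq_trans _ lN).
  exists g; split=> //.
  have : big < l%:R.
    apply: lt_le_trans (_ : (Num.bound big)%:R <= _); last by rewrite ler_nat ltnW.
    by rewrite archi_boundP // divr_ge0 // ltW.
  by rewrite ltr_pdivrMr // => hbig; lra.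
move: hN; rewrite ltr_pdivlMr ?ltr_wpDl // => hN.
have := eta_le N; have := prob_ge0 mu (Q N); lra.
Qed.

Lemma not_above psi t s (x : B) : boundary x -> ~ above psi t x -> t < s ->
  exists N, forall k g, (N <= k)%N -> len g = k -> W D g x -> psi g <= k%:R * s.
Proof.
move=> bx nab ts; apply: contrapT => /forallNP H; apply: nab; split=> //.
exists s => // N; have /existsNP[k /existsNP[g]] := H N.
move=> /not_implyP[kN /not_implyP[lg /not_implyP[Wx /negP]]].
by rewrite -ltNge; exists k => //; exists g.
Qed.

(** The sets [above] use elements near geodesics from [1], while [r] may start anywhere; the two
    differ by a bounded distance depending on [len (r 0)], which disappears after division by
    [n]. *)
Lemma not_above_cvg (Lam : R) (xi : bpoint S) r : bclass xi r ->
  (forall n, ~ above phi (Lam + n.+1%:R^-1) (Bd xi)) ->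
  (forall n, ~ above (fun g => - phi g) (- Lam + n.+1%:R^-1) (Bd xi)) ->
  (fun n : nat => phi (r n) / n%:R) @ \oo --> Lam.
Proof.
move=> xir nab1 nab2; have gr := bclass_ray xir.
have bx : boundary (Bd xi) by exists xi.
have sr n : shadow (2 * len (r 0%N)) (r n) (Bd xi).
  exists r => //; exists n => j nj; rewrite (gr _ _ nj).
  have := geodesic_ray_len symS genS j gr; have := gr 0%N n (leq0n n).
  have := wdist_triangle genS (r 0%N) 1%g (r n); rewrite !wdist1g.
  by move: nj; clear; lia.
pose c5 := (4 * len (r 0%N) + 4 * D)%N; pose c6 := c * (c5%:R + 1).
have c60 : 0 <= c6 by rewrite mulr_ge0 // addr_ge0.
have cmp n : exists g, [/\ len g = n, W D g (Bd xi), phi (r n) <= phi g + c6 &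
    phi g <= phi (r n) + c6].
  have [g lg sg] := shadow_ex symS genS hypD xi n.
  have dg : (dist g (r n) <= c5)%N.
    have := shadow_dist symS genS hypD sg (sr n).
    have := geodesic_ray_len symS genS n gr; have := gr 0%N n (leq0n n).
    have := wdist_triangle genS (r 0%N) 1%g (r n); rewrite !wdist1g lg /c5.
    by clear; lia.
  exists g; split=> //; first exact: W_shadow.
    by apply: lipschitz_dist; rewrite wdistC.
  exact: lipschitz_dist.
apply/cvgrPdist_lt => e e0.
have e4 : 0 < e / 4 by rewrite divr_gt0.
have /cvgrPdist_lt/(_ _ e4)[j _ /(_ j (leqnn j))] := @cvg_harmonic R.
rewrite /= sub0r normrN ger0_norm ?invr_ge0 // => he.
have {}he : (j.+1%:R^-1 : R) < e / 4 := he.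
have j0 : 0 < (j.+1%:R^-1 : R) by rewrite invr_gt0.
have lt_e2 : (j.+1%:R^-1 : R) < e / 2 by apply: lt_trans he _; lra.
have [|N1 hN1] := not_above (s := Lam + e / 2) bx (nab1 j); first by rewrite ltrD2l.
have [|N2 hN2] := not_above (s := - Lam + e / 2) bx (nab2 j); first by rewrite ltrD2l.
exists (N1 + N2 + Num.bound (2 * c6 / e)).+1%N => // n /= nN.
have [g [lg Wg h1 h2]] := cmp n.
have nB : (N1 + N2 + Num.bound (2 * c6 / e) < n)%N by [].
have g1 : phi g <= n%:R * (Lam + e / 2).
  by apply: hN1 => //; move: nB; clear; lia.
have g2 : - phi g <= n%:R * (- Lam + e / 2).
  by apply: (hN2 n g) => //; move: nB; clear; lia.
have n0 : 0 < n%:R :> R by rewrite ltr0n (leq_ltn_trans _ nB).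
have : 2 * c6 / e < n%:R.
  apply: lt_le_trans (_ : (Num.bound (2 * c6 / e))%:R <= _).
    by rewrite archi_boundP // divr_ge0 ?(ltW e0) // mulr_ge0.
  by rewrite ler_nat (leq_trans (leq_addl _ _) (ltnW nB)).
rewrite ltr_pdivrMr // => hn.
have -> : Lam - phi (r n) / n%:R = (n%:R * Lam - phi (r n)) / n%:R.
  by rewrite mulrBl mulrAC divff ?mul1r // gt_eqF.
rewrite normrM normfV (gtr0_norm n0) ltr_pdivrMr // ltr_norml.
by apply/andP; split; nra.
Qed.

(** If [Lam] were negative, the windows of the elements of length [k] with [phi g > k * s] would
    cover a set of small measure for large [k]. Windows have mass comparable with [lam ^- k] and
    bounded multiplicity, so these elements form less than half of the sphere, and some [g] avoids
    them together with its inverse. *)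
Lemma drift_nonneg (Lam : R) : m boundary = 1 ->
  (forall t, Lam < t -> m (above phi t) = 0) -> 0 <= Lam.
Proof.
move=> mb H; rewrite leNgt; apply/negP => Lam0.
(* Any choice with [Lam < t < s < 0] serves: points in infinitely many of the sets [V k] below are
   above [t]. *)
pose s := Lam / 2; pose t := Lam * (3 / 4).
have ts : t < s by rewrite /t /s; lra.
have Lt : Lam < t by rewrite /t; lra.
have [n hn] := geometric_small (divr_gt0 (@ltr01 R) (ltr0n R 2)).
pose q k := [seq g <- sphere S k | k%:R * s < phi g].
pose V k : set B := [set x | exists2 g, g \in q k & (W (2 * n) g `&` boundary) x].
have mWb g : measurable (W (2 * n) g `&` boundary).
  by apply: measurableI => //; exact: boundary_measurable.
have mV k : measurable (V k) by exact: (prob_bigcup_le mu _ mWb).1.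
have mA := above_measurable phi t.
pose F k := \bigcup_(j in [set j | (k <= j)%N]) V j `\` above phi t.
have mF k : measurable (F k) by apply: measurableD => //; exact: bigcup_measurable.
pose M : R := (size (Defs.ball S (2 * n + 5 * D)))%:R.
have M0 : 0 <= M by [].
(* With windows of mass at least [1 / 2 / lam ^+ k] and multiplicity at most [M], this leaves fewer
   than [lam ^+ k / 2] elements in [q k]. *)
have e1 : 0 < 1 / (4 * (M + 1)) by rewrite divr_gt0 // mulr_gt0 // ltr_wpDl.
have [|x|N hN] := prob_vanish mu mF _ _ e1.
- by move=> k; apply: setSD => x [j /= kj Vj]; exists j => //=; exact: ltnW.
- apply: contrapT => /forallNP HF; have {}HF k : F k x by apply: contrapT.
  have [[_ _ [g _ [_ bx]]] nab] := HF 0%N; apply: nab; have [xi xE] := bx.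
  pose c7 := c * ((2 * n + 5 * D)%:R + 1).
  apply: (@aboveI phi t s c7) => // k; have [[j kj [g']]] := HF k.
  rewrite mem_filter mem_sphere // => /andP[hg' /eqP lg'] [Wg' _] _.
  have [h lh sh] := shadow_ex symS genS hypD xi j; rewrite -xE in sh.
  exists j => //; exists h; split=> //; first exact: W_shadow.
  apply: le_trans (ltW hg') _; apply: lipschitz_dist.
  have := shadow_dist symS genS hypD (shadow_W Wg') sh; rewrite lg' lh.
  by clear; lia.
(* The successor makes [k] positive, so that [k * s] is strictly negative at the end. *)
pose k := N.+1.
have mVk : m (V k) < 1 / (4 * (M + 1)).
  apply: le_lt_trans hN; have := probDI mu (mV k) mA.
  have : m (V k `&` above phi t) <= m (above phi t).
    by apply: prob_le => [||x []//]; first exact: measurableI.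
  have : m (V k `\` above phi t) <= m (F N).
    apply: prob_le => //; first exact: measurableD.
    by apply: setSD => x Vx; exists k => //=.
  by rewrite (H t Lt); have := prob_ge0 mu (V k `&` above phi t); lra.
have lk : 0 < lam ^+ k by rewrite exprn_gt0.
have le_q : (size (q k))%:R * (1 / 2 / lam ^+ k) <= M * m (V k).
  apply: le_trans (window_sum_le (2 * n) k (mV k)).
  apply: (@le_trans _ _ (\sum_(g <- q k) m (V k `&` W (2 * n) g))); last first.
    apply: ler_sum_subset => [||g|g]; [exact/filter_uniq/sphere_uniq|exact: sphere_uniq| |].
      by rewrite mem_filter => /andP[].
    exact: prob_ge0.
  rewrite mulr_natl -iter_addr_0 -count_predT -big_const_seq.
  rewrite [leLHS]big_seq [leRHS]big_seq; apply: ler_sum => g gq.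
  have bP : cact g @^-1` boundary = boundary.
    apply/seteqP; split=> x /=; last exact: boundary_cact.
    by move=> /(boundary_cact g^-1%g); rewrite cactK.
  have lgk : len g = k.
    by move: gq; rewrite mem_filter mem_sphere // => /andP[_ /eqP].
  have := @window_ge n g boundary boundary_measurable bP; rewrite mb lgk => wg.
  apply: (@le_trans _ _ (m (boundary `&` W (2 * n) g))).
    apply: le_trans wg; rewrite ler_wpM2r ?invr_ge0 ?(ltW lk) //; lra.
  apply: prob_le; [|exact: measurableI|].
    by apply: measurableI => //; exact: boundary_measurable.
  by move=> x [bx Wx]; split=> //; exists g.
have small_q : (2 * size (q k) < size (sphere S k))%N.
  rewrite -(ltr_nat R) natrM; apply: lt_le_trans (s_ge k).
  have h1 : M * m (V k) < 1 / 4.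
    apply: (@le_lt_trans _ _ ((M + 1) * m (V k))).
      by rewrite ler_wpM2r ?prob_ge0 // lerDl.
    have M1 : 0 < M + 1 by rewrite ltr_wpDl.
    by rewrite -ltr_pdivlMl // (lt_le_trans mVk) // invfM !mul1r mulrC.
  have : (size (q k))%:R * (1 / 2 / lam ^+ k) < 1 / 4 by exact: le_lt_trans h1.
  rewrite mulrA ltr_pdivrMr //; move: ((size (q k))%:R : R) (lam ^+ k) => a b; lra.
have : exists2 g, g \in sphere S k & (g \notin q k) && (g^-1%g \notin q k).
  apply: contrapT => noG; move: small_q; rewrite ltnNge => /negP; apply.
  rewrite mul2n -addnn -[X in (_ <= _ + X)%N](size_map (fun g : G => g^-1)%g) -size_cat.
  apply: uniq_leq_size; first exact: sphere_uniq.
  move=> g gk; rewrite mem_cat; apply: contrapT => /negP.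
  rewrite negb_or => /andP[nq nq']; apply: noG; exists g => //; rewrite nq /=.
  apply/negP => qV; move/negP: nq'; apply; apply/mapP; exists g^-1%g => //.
  by rewrite invgK.
move=> [g]; rewrite mem_sphere // => /eqP lg.
have qE (h : G) : (h \in q k) = (k%:R * s < phi h) && (h \in sphere S k).
  by rewrite mem_filter.
rewrite !qE !mem_sphere // (wordlenV symS genS) lg eqxx !andbT -!leNgt.
move=> /andP[h1 h2].
have k0 : 0 < k%:R :> R by rewrite ltr0n.
have := sub g g^-1%g; have := sub 1%g 1%g; rewrite mulgV mulg1.
have : k%:R * s < 0 by rewrite pmulr_rlt0 // /s; lra.
lra.
Qed.

Lemma drift : exists Lam : R, 0 <= Lam /\ forall n,
  m (above phi (Lam + n.+1%:R^-1)) = 0 /\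
  m (above (fun g => - phi g) (- Lam + n.+1%:R^-1)) = 0.
Proof.
have zero_one t := above_01 t lip c0 subadditive_left_coarse.
have zero_oneN t := above_01 t lipschitzN c0 left_coarseN.
(* A null boundary makes both kinds of sets null for any constant, so [0] serves in that case. *)
have [mb0|mb1] := ergodic boundary_measurable boundary_cact.
  have nul psi t : m (above psi t) = 0.
    apply/eqP; rewrite eq_le prob_ge0 andbT -mb0; apply: prob_le => [||x []//].
      exact: above_measurable.
    exact: boundary_measurable.
  by exists 0; split=> // n; split; exact: nul.
have above_anti psi t t' : t <= t' -> above psi t' `<=` above psi t.
  move=> tt' x [bx [s ts H]]; split=> //; exists s => //; exact: le_lt_trans ts.
(* By the zero-one law, [sup T] is the almost sure upper limit of the slopes. *)
pose T := [set t | m (above phi t) = 1].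
have bound g : `|phi g - phi 1%g| <= c * ((len g)%:R + 1).
  by have := lip g 1%g; rewrite wdistg1.
have T_low : T (- c - 1).
  rewrite /T /= (_ : above _ _ = boundary) //; apply/seteqP; split=> [x []//|x bx].
  have [xi xE] := bx; apply: (@aboveI phi _ (- c) (c - phi 1%g)) => //; first by lra.
  move=> N; have [g lg sg] := shadow_ex symS genS hypD xi N; rewrite -xE in sg.
  exists N => //; exists g; split=> //; first exact: W_shadow.
  have := bound g; rewrite lg ler_norml => /andP[? ?]; nra.
have T_up : ubound T (c + 1).
  move=> t Tt; rewrite leNgt; apply/negP => lt_t.
  suff H0 : above phi t = set0 by move: Tt; rewrite /T /= H0 prob0 => /eqP; rewrite eq_sym oner_eq0.
  apply/seteqP; split=> // x /(above_anti _ _ _ (ltW lt_t))[bx [s cs H]].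
  have [k kN [g [lg _ gx]]] := H (Num.bound `|phi 1%g + c|).
  have : `|phi 1%g + c| < k%:R.
    apply: lt_le_trans (_ : (Num.bound `|phi 1%g + c|)%:R <= _); first exact: archi_boundP.
    by rewrite ler_nat.
  have := bound g; rewrite lg ler_norml => /andP[? ?]; have := ler_norm (phi 1%g + c).
  have k0 : 0 <= k%:R :> R by [].
  have : k%:R * (c + 1) <= k%:R * s by rewrite ler_wpM2l // ltW.
  lra.
have supT : has_sup T by split; [exists (- c - 1)|exists (c + 1)].
have above_sup t : sup T < t -> m (above phi t) = 0.
  move=> lt_t; have [//|Tt] := zero_one t.
  by have := ub_le_sup supT.2 Tt; rewrite leNgt lt_t.
exists (sup T); split; first exact: drift_nonneg.
move=> n; have n0 : 0 < (n.+1%:R^-1 : R) by rewrite invr_gt0.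
split; first by apply: above_sup; rewrite ltrDl.
have [//|m1] := zero_oneN (- sup T + n.+1%:R^-1).
(* Some [t] in [T] exceeds [sup T - 1 / (n + 1)]; a lower limit almost surely below the latter is
   excluded by the disjointness lemma. *)
have [t Tt lt_t] := sup_adherent n0 supT.
by case: (above_disjoint lt_t Tt); rewrite opprB addrC.
Qed.

End Subadditive.
End Ergodicity.

(** Subadditivity along a shortest word bounds [phi] above linearly; applied to [u^-1 v] and to
    [v^-1 u], this bounds the difference from both sides. *)
Lemma subadditive_lipschitz (R : realType) (G : groupType) (S : seq G) (phi : G -> R) :
  symmetric_gen S -> generates S -> subadditive_fun phi -> exists2 c, 0 <= c & word_lipschitz S c phi.
Proof.
move=> symS genS sub; pose c := `|phi 1%g| + \sum_(s <- S) `|phi s|.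
have c0 : 0 <= c by rewrite addr_ge0 // sumr_ge0.
have bnd g : phi g <= c * ((wordlen S g)%:R + 1).
  have [w [wS <- <-]] := wordlen_ex genS g; elim: w wS => [_|a w IH /= /andP[aS wS]].
    by rewrite /= add0r mulr1 (le_trans (ler_norm _)) // lerDl sumr_ge0.
  apply: le_trans (sub _ _) _.
  have a_le : phi a <= c.
    apply: le_trans (ler_norm _) _; rewrite /c (big_rem a) //=.
    by rewrite addrCA lerDl addr_ge0 // sumr_ge0.
  by have := IH wS; rewrite -[(size w).+1]addn1 natrD; lra.
exists c => // u v; rewrite ler_norml; apply/andP; split.
  have := bnd (u^-1 * v)%g; have := sub u (u^-1 * v)%g.
  by rewrite mulVKg -/(wdist S u v); lra.
have := bnd (v^-1 * u)%g; have := sub v (v^-1 * u)%g.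
by rewrite mulVKg -/(wdist S v u) wdistC //; lra.
Qed.

Theorem theorem1p9 (R : realType) (G : groupType) (S : seq G) (lam : R)
    (phi : G -> R) (nu : probability (borel_space S R) R) :
  symmetric_gen S -> generates S ->
  gromov_hyperbolic S R -> non_elementary G ->
  growth_rate S lam ->
  subadditive_fun phi ->
  in_PS_class lam nu ->
  exists Lam : R, 0 <= Lam /\
    {ae nu, forall x : borel_space S R, forall xi : bpoint S,
        x = Bd xi -> forall r : nat -> G, bclass xi r ->
        (fun n : nat => phi (r n) / n%:R) @ \oo --> Lam}.
Proof.
move=> symS genS hyp neG lamP sub [mu [psmu [nu_mu _]]].
have [D hypD] := gromov_four_point symS genS hyp.
have [lam1 [C s_le]] := sphere_growth symS genS neG hypD lamP.
have s_ge := sphere_ge genS neG lamP.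
have quasi := quasi_lower symS genS hypD lam1 s_ge s_le psmu.
have /choice[W hW] := fun rg : nat * G =>
  shadow_window symS genS hypD lam1 s_ge s_le psmu rg.2 rg.1.
pose V r g := W (r, g).
have mV r g : measurable (V r g) by have [] := hW (r, g).
have V_shadow r g x : shadow r g x -> V r g x.
  by have [_ h _ _] := hW (r, g); exact: h.
have shadow_V r g x : V r g x -> shadow (r + 2 * D) g x.
  by have [_ _ h _] := hW (r, g); exact: h.
have V_quasi r g A := let: And4 _ _ _ h := hW (r, g) in h A.
have [c c0 lip] := subadditive_lipschitz symS genS sub.
have [Lam [Lam0 null]] := drift symS genS hypD lam1 s_ge s_le quasi mV V_shadow
  shadow_V V_quasi c0 lip sub.
exists Lam; split=> //.
(* Countably many [mu]-null sets, hence [nu]-null; outside them the limit exists along every ray of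
   the class. *)
pose N n : set (borel_space S R) := above D V phi (Lam + n.+1%:R^-1) `|`
  above D V (fun g => - phi g) (- Lam + n.+1%:R^-1).
have mA psi t : measurable (above D V psi t) by exact: above_measurable.
have nuN n : nu.-negligible (N n).
  have [h1 h2] := null n.
  apply: negligibleU; apply/negligibleP => //; apply: nu_mu => //.
    by rewrite probE // h1.
  by rewrite probE // h2.
apply: negligibleS (negligible_bigcup nuN) => x /= nP; apply: contrapT => nN.
apply: nP => xi xE r xir.
have nab n : ~ N n (Bd xi) by rewrite -xE => Nx; apply: nN; exists n.
apply: (not_above_cvg symS genS hypD V_shadow c0 lip xir) => n ab; apply: (nab n).
  by left.
by right.
Qed.
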